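(* For any ordinal $\xi$, any natural number $n$, any $\delta>0$, and any bounded function $f:\Gamma_{\xi,n}\to\mathbb{R}$, there exist numbers $a_1,\ldots,a_n\in\mathbb{R}$, a monotone function $\theta:\Gamma_{\xi,n}\to\Gamma_{\xi,n}$, and an extension $e$ of $\theta$ such that (i) for every $t\in MAX(\Gamma_{\xi,n})$, $\sum_{s\preceq e(t)}\mathbb{P}_{\xi,n}(s)f(s)\leqslant\delta+\sum_{i=1}^na_i$, and (ii) for every $1\leqslant i\leqslant n$ and every $s\in\Lambda_{\xi,n,i}$, $f(\theta(s))\geqslant a_i$.
   Context: Sequences are finite; $s\prec t$ ($s\preceq t$) means $s$ is a proper (not necessarily proper) initial segment of $t$; $s^\frown t$ is concatenation; $MAX(S)$ is the set of $\preceq$-maximal members of $S$. For an ordinal $\zeta$ and a sequence of ordinals, $\zeta+(\zeta_i)_{i=1}^n=(\zeta+\zeta_i)_{i=1}^n$; $\zeta+S=\{\zeta+s:s\in S\}$. Define sets of non-empty finite sequences of ordinals by: $\Gamma_0=\{(0)\}$; given $\Gamma_\xi$, $\Gamma_{\xi,1}=\Gamma_\xi$, $\Gamma_{\xi,n+1}=(\omega^\xi n+\Gamma_\xi)\cup\{t^\frown u:t\in MAX(\omega^\xi n+\Gamma_\xi),u\in\Gamma_{\xi,n}\}$, $\Gamma_{\xi+1}=\bigcup_{n\ge1}\Gamma_{\xi,n}$ (a disjoint union); for limit $\xi$, $\Gamma_\xi=\bigcup_{\zeta<\xi}(\omega^\zeta+\Gamma_{\zeta+1})$ (a disjoint union).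 Each $t\in\Gamma_{\xi,n}$ is uniquely of the form $(\omega^\xi(n-1)+t_1)^\frown\cdots^\frown(\omega^\xi(n-m)+t_m)$ with $1\leqslant m\leqslant n$, $t_i\in\Gamma_\xi$, and $t_i\in MAX(\Gamma_\xi)$ for $i<m$. Then $t$ is on level $m$; $\Lambda_{\xi,n,m}$ is the set of members of $\Gamma_{\xi,n}$ on level $m$; and $\iota_{\xi,n}(t)=t_m\in\Gamma_\xi$. Define $\mathbb{P}_\xi:\Gamma_\xi\to[0,1]$ by $\mathbb{P}_0((0))=1$; $\mathbb{P}_{\xi+1}(t)=\frac1n\mathbb{P}_\xi(\iota_{\xi,n}(t))$ for $t\in\Gamma_{\xi,n}$; for limit $\xi$, $\mathbb{P}_\xi(\omega^\zeta+t')=\mathbb{P}_{\zeta+1}(t')$ for $\zeta<\xi$, $t'\in\Gamma_{\zeta+1}$. Put $\mathbb{P}_{\xi,n}(s)=\mathbb{P}_\xi(\iota_{\xi,n}(s))$ for $s\in\Gamma_{\xi,n}$; thus $\sum_{\Lambda_{\xi,n,i}\ni s\preceq t}\mathbb{P}_{\xi,n}(s)=1$ for $t\in MAX(\Gamma_{\xi,n})$, $1\leqslant i\leqslant n$. $\theta:\Gamma_{\xi,n}\to\Gamma_{\xi,n}$ is monotone if $s\prec t$ implies $\theta(s)\prec\theta(t)$. An extension of a monotone $\theta$ is a function $e:MAX(\Gamma_{\xi,n})\to MAX(\Gamma_{\xi,n})$ with $\theta(t)\preceq e(t)$ for every $t\in MAX(\Gamma_{\xi,n})$. *)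

(* Defs.v *)
From HB Require Import structures.
From mathcomp Require Import all_boot all_order all_algebra.
From mathcomp Require Import generic_quotient boolp classical_sets functions.
From mathcomp Require Import fsbigop reals.

Set Implicit Arguments.
Unset Strict Implicit.
Unset Printing Implicit Defensive.

Import Order.TTheory GRing.Theory Num.Theory.

Local Open Scope classical_set_scope.
Local Open Scope quotient_scope.

(* A tree [OTree f] denotes the least ordinal strictly above all the ordinals
   denoted by the [f a].  Every ordinal arises in this way from a family indexed
   by a small type, and [Ord] below is the type of trees modulo the equality of
   the ordinals they denote. *)

Inductive otree : Type := OTree (A : Type) of (A -> otree).

Definition oindex (x : otree) : Type := let: @OTree A _ := x in A.

Definition ochild (x : otree) : oindex x -> otree :=
  match x with OTree A f => f end.

Fixpoint ole (x y : otree) : Prop :=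
  match x, y with
  | OTree A f, OTree B g => forall a : A, exists b : B, ole (f a) (g b)
  end.

Definition olt (x y : otree) : Prop := exists b : oindex y, ole x (ochild b).

Lemma oleE x y : ole x y <-> forall a : oindex x, olt (ochild a) y.
Proof. by case: x; case: y. Qed.

Lemma ole_refl x : ole x x.
Proof. by elim: x => A f IH a; exists a; exact: IH. Qed.

Lemma ole_trans y x z : ole x y -> ole y z -> ole x z.
Proof.
elim: x y z => A f IH [B g] [C h] xy yz a.
have [b fg] := xy a; have [c gh] := yz b.
by exists c; exact: IH fg gh.
Qed.

Lemma ole_lt_trans y x z : ole x y -> olt y z -> olt x z.
Proof. by move=> xy [c yc]; exists c; exact: ole_trans yc. Qed.

Lemma olt_le_trans y x z : olt x y -> ole y z -> olt x z.
Proof. by move=> [b xb] /oleE/(_ b); exact: ole_lt_trans. Qed.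

Lemma olt_child x (a : oindex x) : olt (ochild a) x.
Proof. by exists a; exact: ole_refl. Qed.

Lemma oltW x y : olt x y -> ole x y.
Proof.
elim: y x => B g IH x [b /oleE xb].
by apply/oleE => a; exists b; apply: IH; exact: xb.
Qed.

Lemma ole_or_lt x y : ole x y \/ olt y x.
Proof.
elim: x y => A f IH y; case: (pselect (exists a, ole y (f a))) => [[a ya]|H].
  by right; exists a.
left; apply/oleE => a /=; apply: contrapT => nfy; apply: H; exists a.
apply/oleE => b; have [fb|//] := IH a (ochild b).
by case: nfy; exists b.
Qed.

Lemma olt_wf : well_founded olt.
Proof.
suff H x : forall y, ole y x -> Acc olt y by move=> x; exact: (H x _ (ole_refl x)).
elim: x => A f IH y yx; constructor=> z zy.
have [a za] := olt_le_trans zy yx.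
exact: IH za.
Qed.

Lemma olt_irr x : ~ olt x x.
Proof.
by elim/(well_founded_ind olt_wf): x => x IH xx; exact: (IH x xx xx).
Qed.

Lemma oltNle x y : olt x y <-> ~ ole y x.
Proof.
split=> [xy yx|nyx]; first exact: (@olt_irr x (olt_le_trans xy yx)).
by have [|//] := ole_or_lt y x.
Qed.

HB.instance Definition _ := gen_eqMixin otree.
HB.instance Definition _ := gen_choiceMixin otree.

Definition oeqb (x y : otree) : bool := `[< ole x y /\ ole y x >].

Lemma oeqb_refl : reflexive oeqb.
Proof. by move=> x; apply/asboolP; split; exact: ole_refl. Qed.

Lemma oeqb_sym : symmetric oeqb.
Proof. by move=> x y; apply/asboolP/asboolP => -[]. Qed.

Lemma oeqb_trans : transitive oeqb.
Proof.
move=> y x z /asboolP[xy yx] /asboolP[yz zy].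
by apply/asboolP; split; [exact: ole_trans yz|exact: ole_trans yx].
Qed.

Canonical oeqb_equiv := EquivRel oeqb oeqb_refl oeqb_sym oeqb_trans.

Definition Ord : Type := {eq_quot oeqb}.
HB.instance Definition _ := Choice.on Ord.

Definition otree_of (a : Ord) : otree := repr a.
Definition ord_of (x : otree) : Ord := \pi_Ord x.

Lemma otree_ofK a : ord_of (otree_of a) = a.
Proof. exact: reprK. Qed.

Lemma ord_ofK x : ole (otree_of (ord_of x)) x /\ ole x (otree_of (ord_of x)).
Proof.
by apply/asboolP; have /eqmodP := otree_ofK (ord_of x).
Qed.

Definition ord_le (a b : Ord) : bool := `[< ole (otree_of a) (otree_of b) >].
Definition ord_lt (a b : Ord) : bool := `[< olt (otree_of a) (otree_of b) >].

Lemma ord_le_refl : reflexive ord_le.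
Proof. by move=> a; apply/asboolP; exact: ole_refl. Qed.

Lemma ord_le_anti : antisymmetric ord_le.
Proof.
move=> a b /andP[/asboolP ab /asboolP ba].
by rewrite -(otree_ofK a) -(otree_ofK b); apply/eqmodP; apply/asboolP.
Qed.

Lemma ord_le_trans : transitive ord_le.
Proof.
move=> b a c /asboolP ab /asboolP bc; apply/asboolP; exact: ole_trans bc.
Qed.

Lemma ord_le_total : total ord_le.
Proof.
move=> a b; case: (ole_or_lt (otree_of a) (otree_of b)) => [ab|/oltW ab].
  by apply/orP; left; apply/asboolP.
by apply/orP; right; apply/asboolP.
Qed.

Lemma ord_lt_def a b : ord_lt a b = (b != a) && ord_le a b.
Proof.
apply/asboolP/andP => [/oltNle ab|[ba ab]].
  split; first by apply/eqP => ba; apply: ab; rewrite ba; exact: ole_refl.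
  by have /orP[//|/asboolP] := ord_le_total a b.
apply/oltNle => /asboolP ba'; move/eqP: ba; apply.
by apply: ord_le_anti; rewrite ab andbT.
Qed.

Fact ord_display : Order.disp_t. Proof. exact: Order.Disp tt tt. Qed.

HB.instance Definition _ := @Order.isPOrder.Build ord_display Ord
  ord_le ord_lt ord_lt_def ord_le_refl ord_le_anti ord_le_trans.
HB.instance Definition _ :=
  @Order.POrder_isTotal.Build ord_display Ord ord_le_total.

Lemma ord_leP (a b : Ord) :
  reflect (ole (otree_of a) (otree_of b)) (a <= b)%O.
Proof. exact: asboolP. Qed.

Lemma ord_ltP (a b : Ord) :
  reflect (olt (otree_of a) (otree_of b)) (a < b)%O.
Proof. exact: asboolP. Qed.

Lemma ord_lt_wf : well_founded (fun a b : Ord => (a < b)%O).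
Proof.
suff H x : forall a : Ord, otree_of a = x -> Acc (fun a b : Ord => (a < b)%O) a.
  by move=> a; exact: H.
elim/(well_founded_ind olt_wf): x => x IH a ax; constructor => b /ord_ltP ba.
by apply: (IH (otree_of b)) => //; rewrite -ax.
Qed.

Definition ozero : Ord := ord_of (OTree (fun v : void => match v with end)).

Definition osucc (a : Ord) : Ord := ord_of (OTree (fun _ : unit => otree_of a)).

Lemma ozero_le a : (ozero <= a)%O.
Proof.
by apply/ord_leP; apply: (ole_trans (ord_ofK _).1); case: (otree_of a) => B g [].
Qed.

Lemma lt_osucc a b : (a < osucc b)%O = (a <= b)%O.
Proof.
apply/ord_ltP/ord_leP => [ab|ab].
  by have [] := olt_le_trans ab (ord_ofK _).1.
by apply: olt_le_trans (ord_ofK _).2; exists tt.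
Qed.

Lemma osucc_gt a : (a < osucc a)%O.
Proof. by rewrite lt_osucc. Qed.

Lemma osucc_le a b : (osucc a <= b)%O = (a < b)%O.
Proof. by rewrite leNgt lt_osucc -ltNge. Qed.

Lemma osucc_inj : injective osucc.
Proof.
move=> a b ab; apply/le_anti; rewrite -!lt_osucc ab osucc_gt /=.
by rewrite -ab osucc_gt.
Qed.

Lemma osucc_neq0 a : osucc a != ozero.
Proof. by rewrite gt_eqF// (le_lt_trans (ozero_le a))// osucc_gt. Qed.

Definition is_limit (a : Ord) : Prop :=
  a != ozero /\ forall b, a <> osucc b.

Lemma limit_osucc a b : is_limit a -> (b < a)%O -> (osucc b < a)%O.
Proof.
move=> [_ al]; rewrite -osucc_le le_eqVlt => /orP[/eqP ba|//].
by have := al b; rewrite ba.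
Qed.

Lemma limit_gt0 a : is_limit a -> (ozero < a)%O.
Proof. by move=> [a0 _]; rewrite lt_neqAle eq_sym a0 ozero_le. Qed.

(* The values below an ordinal form a small family, so that every family of
   ordinals indexed by the ordinals below a given one has a least upper bound. *)
Lemma ord_small_below (x : otree) : exists (B : Type) (g : B -> Ord),
  forall a : Ord, (a < ord_of x)%O <-> exists b, a = g b.
Proof.
elim: x => A f IH.
have [B BP] := choice IH; pose g a := projT1 (cid (BP a)).
have gP a c : (c < ord_of (f a))%O <-> exists b, c = g a b.
  exact: (projT2 (cid (BP a))).
exists {a : A & option (B a)}.
exists (fun p => if tagged p is Some b then g (tag p) b else ord_of (f (tag p))).
move=> c; split=> [/ord_ltP cf|[[a [b|]] ->] /=].
- have [a ca] := olt_le_trans cf (ord_ofK _).1.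
  have : (c <= ord_of (f a))%O.
    by apply/ord_leP; exact: ole_trans (ord_ofK _).2.
  rewrite le_eqVlt => /orP[/eqP ->|/gP[b ->]]; first by exists (existT _ a None).
  by exists (existT _ a (Some b)).
- have /lt_trans : (g a b < ord_of (f a))%O by apply/gP; exists b.
  apply; apply/ord_ltP; apply: olt_le_trans (ord_ofK _).2.
  by exists a; exact: (ord_ofK _).1.
- apply/ord_ltP; apply: olt_le_trans (ord_ofK _).2.
  by exists a; exact: (ord_ofK _).1.
Qed.

Lemma ord_wf_min (S : set Ord) : S !=set0 -> exists2 a, S a & lbound S a.
Proof.
move=> [a]; elim/(well_founded_ind ord_lt_wf): a => a IH Sa.
have [[b [Sb ba]]|H] := pselect (exists b, S b /\ (b < a)%O); first exact: IH ba Sb.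
by exists a => // b Sb; rewrite leNgt; apply/negP => ba; apply: H; exists b.
Qed.

Lemma small_supremums (B : Type) (g : B -> Ord) : supremums (range g) !=set0.
Proof.
have : ubound (range g) !=set0.
  exists (ord_of (OTree (fun b => otree_of (g b)))) => _ [b _ <-].
  apply/ltW/ord_ltP; apply: olt_le_trans (ord_ofK _).2.
  by exists b; exact: ole_refl.
by move=> /ord_wf_min[a ua la]; exists a.
Qed.

Lemma below_supremums (F : Ord -> Ord) (a : Ord) :
  supremums [set F b | b in [set b | (b < a)%O]] !=set0.
Proof.
have [B [g gP]] := ord_small_below (otree_of a); rewrite otree_ofK in gP.
have [s [us ls]] := small_supremums (F \o g); exists s; split.
  by move=> _ [b /gP[c ->] <-]; apply: us; exists c.
move=> u uu; apply: ls => _ [c _ <-]; apply: uu; exists (g c) => //=.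
by apply/gP; exists c.
Qed.

(* [ord_rec z s l] has value [z] at zero, [s b v] at the successor of [b] when
   its value at [b] is [v], and [l a F] at a limit [a], where [F] gives its
   values below [a] (and the irrelevant [z] elsewhere). *)

Section OrdRec.
Variables (T : Type) (z : T) (s : Ord -> T -> T) (l : Ord -> (Ord -> T) -> T).

Definition ord_rec_body (a : Ord)
    (rec : forall b : Ord, (b < a)%O -> T) : T :=
  let F b := if pselect (b < a)%O is left ba then rec b ba else z in
  if a == ozero then z
  else if pselect (exists b, a = osucc b) is left h
  then s (projT1 (cid h)) (F (projT1 (cid h)))
  else l a F.

Definition ord_rec : Ord -> T := Fix ord_lt_wf (fun=> T) ord_rec_body.

Lemma ord_recE a : ord_rec a = @ord_rec_body a (fun b _ => ord_rec b).
Proof.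
rewrite /ord_rec Fix_eq// => b F G FG; congr ord_rec_body.
by apply: functional_extensionality_dep => c; apply: functional_extensionality_dep.
Qed.

Lemma ord_rec0 : ord_rec ozero = z.
Proof. by rewrite ord_recE /ord_rec_body eqxx. Qed.

Lemma ord_recS a : ord_rec (osucc a) = s a (ord_rec a).
Proof.
rewrite ord_recE /ord_rec_body (negbTE (osucc_neq0 a)).
case: pselect => [h|]; last by case; exists a.
case: cid => b /= /osucc_inj <-; case: pselect => //.
by rewrite osucc_gt.
Qed.

Lemma ord_recL a : is_limit a ->
  (forall F G, (forall b, (b < a)%O -> F b = G b) -> l a F = l a G) ->
  ord_rec a = l a ord_rec.
Proof.
move=> [a0 al] lE; rewrite ord_recE /ord_rec_body (negbTE a0).
case: pselect => [[b ab]|_]; first by have := al b ab.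
by apply: lE => b ba; case: pselect.
Qed.

End OrdRec.

Definition osup (F : Ord -> Ord) (a : Ord) : Ord :=
  supremum ozero [set F b | b in [set b | (b < a)%O]].

Definition oadd (a : Ord) : Ord -> Ord :=
  ord_rec a (fun _ c => osucc c) (fun b F => osup F b).

Definition omul (a : Ord) : Ord -> Ord :=
  ord_rec ozero (fun _ c => oadd c a) (fun b F => osup F b).

Definition oexp (a : Ord) : Ord -> Ord :=
  ord_rec (osucc ozero) (fun _ c => omul c a) (fun b F => osup F b).

Definition onat (n : nat) : Ord := iter n osucc ozero.

Definition omega : Ord := supremum ozero (range onat).

Definition omegaX (a : Ord) : Ord := oexp omega a.

Lemma eq_osup F G a : (forall b, (b < a)%O -> F b = G b) -> osup F a = osup G a.
Proof. by move=> FG; congr supremum; apply: eq_imagel => b /=; exact: FG. Qed.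

Lemma oadd0 a : oadd a ozero = a.
Proof. exact: ord_rec0. Qed.

Lemma oaddS a b : oadd a (osucc b) = osucc (oadd a b).
Proof. exact: ord_recS. Qed.

Lemma oaddL a b : is_limit b -> oadd a b = osup (oadd a) b.
Proof. by move=> bl; apply: ord_recL => // F G; exact: eq_osup. Qed.

Lemma omul0 a : omul a ozero = ozero.
Proof. exact: ord_rec0. Qed.

Lemma omulS a b : omul a (osucc b) = oadd (omul a b) a.
Proof. exact: ord_recS. Qed.

Lemma omulL a b : is_limit b -> omul a b = osup (omul a) b.
Proof. by move=> bl; apply: ord_recL => // F G; exact: eq_osup. Qed.

Lemma oexp0 a : oexp a ozero = osucc ozero.
Proof. exact: ord_rec0. Qed.

Lemma oexpS a b : oexp a (osucc b) = omul (oexp a b) a.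
Proof. exact: ord_recS. Qed.

Lemma oexpL a b : is_limit b -> oexp a b = osup (oexp a) b.
Proof. by move=> bl; apply: ord_recL => // F G; exact: eq_osup. Qed.

Definition proper_prefix (s t : seq Ord) : bool := prefix s t && (s != t).

Definition MAX (S : set (seq Ord)) : set (seq Ord) :=
  [set t | S t /\ forall u, S u -> prefix t u -> u = t].

Definition shift (z : Ord) (s : seq Ord) : seq Ord := [seq oadd z x | x <- s].

(* With [w] = omega^xi and [G] = Gamma_xi this is Gamma_{xi,n}; the value at
   [n = 0] is junk. *)
Fixpoint gamma_iter (w : Ord) (G : set (seq Ord)) (n : nat) : set (seq Ord) :=
  match n with
  | 0 => set0
  | 1 => G
  | (_.+1 as m).+1 =>
      shift (omul w (onat m)) @` G `|`
      [set t ++ u | t in MAX (shift (omul w (onat m)) @` G)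
                  & u in gamma_iter w G m]
  end.

Definition Gamma : Ord -> set (seq Ord) :=
  ord_rec [set [:: ozero]]
    (fun xi G => \bigcup_(n in [set n | (0 < n)%N]) gamma_iter (omegaX xi) G n)
    (fun xi G => \bigcup_(z in [set z | (z < xi)%O])
                   (shift (omegaX z) @` G (osucc z))).

Definition Gamma_n (xi : Ord) (n : nat) : set (seq Ord) :=
  gamma_iter (omegaX xi) (Gamma xi) n.

Lemma Gamma0 : Gamma ozero = [set [:: ozero]].
Proof. exact: ord_rec0. Qed.

Lemma GammaS xi :
  Gamma (osucc xi) = \bigcup_(n in [set n | (0 < n)%N]) Gamma_n xi n.
Proof. exact: ord_recS. Qed.

Lemma GammaL xi : is_limit xi ->
  Gamma xi = \bigcup_(z in [set z | (z < xi)%O])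
               (shift (omegaX z) @` Gamma (osucc z)).
Proof.
move=> xil; apply: (ord_recL _ _ xil) => F G FG.
by apply: eq_bigcupr => z zxi; rewrite FG//; exact: limit_osucc.
Qed.

Lemma Gamma_n1 xi : Gamma_n xi 1 = Gamma xi.
Proof. by []. Qed.

Lemma Gamma_nS xi n : (0 < n)%N ->
  Gamma_n xi n.+1 =
    shift (omul (omegaX xi) (onat n)) @` Gamma xi `|`
    [set t ++ u | t in MAX (shift (omul (omegaX xi) (onat n)) @` Gamma xi)
                & u in Gamma_n xi n].
Proof. by case: n. Qed.

(* [ts] = (t_1, ..., t_m) decomposes [t] in Gamma_{xi,n} as the concatenation of
   the omega^xi (n - i) + t_i; positions in [ts] are counted from 0. *)
Definition decomposition (xi : Ord) (n : nat) (t : seq Ord)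
    (ts : seq (seq Ord)) : Prop :=
  [/\ (1 <= size ts <= n)%N,
      forall i, (i < size ts)%N -> Gamma xi (nth [::] ts i),
      forall i, (i.+1 < size ts)%N -> MAX (Gamma xi) (nth [::] ts i) &
      t = flatten (mkseq (fun i =>
            shift (omul (omegaX xi) (onat (n - i.+1))) (nth [::] ts i))
            (size ts))].

Definition Lambda (xi : Ord) (n m : nat) : set (seq Ord) :=
  [set t | Gamma_n xi n t /\
           exists2 ts, decomposition xi n t ts & size ts = m].

Definition iota_n (xi : Ord) (n : nat) (t : seq Ord) : seq Ord :=
  last [::] (xget [::] [set ts | decomposition xi n t ts]).

Local Open Scope ring_scope.

(* In the successor case [n] is the only index with [t] in Gamma_{xi,n}; in the
   limit case [p] = (zeta, t') is the only pair with [t] = omega^zeta + t',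
   zeta < xi and t' in Gamma_{zeta+1}. Values outside Gamma_xi are junk. *)
Definition prob (R : realType) : Ord -> seq Ord -> R :=
  ord_rec (fun=> 1)
    (fun xi Pxi t =>
       let n := xget 0%N [set n | (0 < n)%N /\ Gamma_n xi n t] in
       n%:R^-1 * Pxi (iota_n xi n t))
    (fun xi F t =>
       let p := xget (ozero, [::])
         [set p : Ord * seq Ord | [/\ (p.1 < xi)%O, Gamma (osucc p.1) p.2
                                    & t = shift (omegaX p.1) p.2]] in
       F (osucc p.1) p.2).

Definition prob_n (R : realType) (xi : Ord) (n : nat) (s : seq Ord) : R :=
  prob R xi (iota_n xi n s).

Lemma prob0 (R : realType) (t : seq Ord) : prob R ozero t = 1.
Proof. by rewrite /prob ord_rec0. Qed.

Lemma probS (R : realType) xi t :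
  prob R (osucc xi) t =
  let n := xget 0%N [set n | (0 < n)%N /\ Gamma_n xi n t] in
  n%:R^-1 * prob R xi (iota_n xi n t).
Proof. by rewrite /prob ord_recS. Qed.

Lemma probL (R : realType) xi t : is_limit xi ->
  prob R xi t =
  let p := xget (ozero, [::])
    [set p : Ord * seq Ord | [/\ (p.1 < xi)%O, Gamma (osucc p.1) p.2
                               & t = shift (omegaX p.1) p.2]] in
  prob R (osucc p.1) p.2.
Proof.
move=> xil; rewrite /prob (ord_recL _ _ xil)// => F G FG.
apply/funext => u; rewrite FG//; apply: limit_osucc => //.
by case: xgetP => [p -> []//|_]; exact: limit_gt0.
Qed.

(* A map from Gamma_{xi,n} to itself is represented by a total function which
   sends [S] = Gamma_{xi,n} into itself; its values outside [S] are irrelevant.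
   Likewise for extensions and [MAX S]. *)
Definition monotone (S : set (seq Ord)) (theta : seq Ord -> seq Ord) : Prop :=
  set_fun S S theta /\
  forall s t, S s -> S t -> proper_prefix s t ->
              proper_prefix (theta s) (theta t).

Definition extension (S : set (seq Ord)) (theta e : seq Ord -> seq Ord) : Prop :=
  set_fun (MAX S) (MAX S) e /\
  forall t, MAX S t -> prefix (theta t) (e t).

(* Main.v *)
Require Import Defs.
From HB Require Import structures.
From mathcomp Require Import all_boot all_order all_algebra.
From mathcomp Require Import boolp classical_sets functions.
From mathcomp Require Import fsbigop reals.
From mathcomp Require Import lra.

(* The case n = 1 is strengthened so that induction on xi goes through: given
   also a finite colouring c of the leaves, theta and e can be chosen with c
   constant along e.  For general n, Gamma_{xi,n+1} is Gamma_xi with a copy of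
   Gamma_{xi,n} on top of every leaf t; one first treats each copy, then colours
   t by the resulting numbers a_i, rounded to a finite grid, and applies the case
   n = 1 to Gamma_xi and this colouring.  For xi = zeta+1, infinitely many of the
   trees Gamma_{zeta,N} agree in colour and in the rounded average A of their
   a_i; as N grows, more and more levels have a_i >= A - eps, and Gamma_{zeta,m}
   embeds into Gamma_{zeta,N} through such levels only.  For limit xi, cofinally
   many of the trees Gamma_{zeta+1} agree in colour and rounded value, and
   Gamma_{zeta+1} embeds into Gamma_{eta+1} whenever zeta <= eta. *)

Import Order.TTheory GRing.Theory Num.Theory.

Local Open Scope classical_set_scope.
Local Open Scope ring_scope.

(** * Ordinal arithmetic *)

Lemma supremum_ub (A : set Ord) x : supremums A !=set0 -> A x ->
  (x <= supremum ozero A)%O.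
Proof. exact: ge_supremum_Nmem. Qed.

Lemma supremum_le (A : set Ord) u : supremums A !=set0 -> ubound A u ->
  (supremum ozero A <= u)%O.
Proof.
move=> [x Ax] uA; rewrite /supremum; case: ifPn => [_|_]; first exact: ozero_le.
by case: xgetP => [y _ [_ ly]|/(_ x)//]; exact: ly.
Qed.

Lemma osup_ub F a b : (b < a)%O -> (F b <= osup F a)%O.
Proof. by move=> ba; apply: supremum_ub; [exact: below_supremums|exists b]. Qed.

Lemma osup_le F a u :
  (forall b, (b < a)%O -> (F b <= u)%O) -> (osup F a <= u)%O.
Proof.
move=> Fu; apply: supremum_le; first exact: below_supremums.
by move=> _ [b ba <-]; exact: Fu.
Qed.

Lemma ord_cases (a : Ord) :
  [\/ a = ozero, exists b, a = osucc b | is_limit a].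
Proof.
have [->|a0] := eqVneq a ozero; first exact: Or31.
have [[b ->]|nb] := pselect (exists b, a = osucc b);
  first by apply: Or32; exists b.
by apply: Or33; split=> // b ab; apply: nb; exists b.
Qed.

Lemma oadd_lt a b c : (b < c)%O -> (oadd a b < oadd a c)%O.
Proof.
elim/(well_founded_ind ord_lt_wf): c b => c IH b bc.
case: (ord_cases c) => [c0|[d cd]|cl].
- by move: bc; rewrite c0 ltNge ozero_le.
- move: bc; rewrite cd oaddS !lt_osucc le_eqVlt => /orP[/eqP -> //|bd].
  by apply/ltW/IH => //; rewrite cd osucc_gt.
- apply: (@lt_le_trans _ _ (oadd a (osucc b))); first by rewrite oaddS osucc_gt.
  by rewrite (oaddL a cl); apply: osup_ub; exact: limit_osucc.
Qed.

Lemma oadd_le_mono a b c : (oadd a b <= oadd a c)%O = (b <= c)%O.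
Proof. exact: (le_mono (fun b c => @oadd_lt a b c)). Qed.

Lemma oadd_inj a : injective (oadd a).
Proof.
by move=> b c bc; apply/le_anti/andP; split; rewrite -(oadd_le_mono a) bc.
Qed.

Lemma le_oadd a b : (a <= oadd a b)%O.
Proof. by rewrite -{1}(oadd0 a) oadd_le_mono ozero_le. Qed.

(** The zero, successor and limit clauses of [oadd] merge into one: a + c is the least ordinal that
    is at least a and strictly above every a + x with x < c. Later inductions on the right summand
    then need no case distinction. *)
Lemma oadd_le a c u : (a <= u)%O -> (forall x, (x < c)%O -> (oadd a x < u)%O) ->
  (oadd a c <= u)%O.
Proof.
move=> au H; case: (ord_cases c) => [->|[d cd]|cl]; first by rewrite oadd0.
- by rewrite cd oaddS osucc_le H// cd osucc_gt.
- by rewrite (oaddL a cl); apply: osup_le => b /H/ltW.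
Qed.

Lemma oadd_assoc_le a b c : (oadd a (oadd b c) <= oadd (oadd a b) c)%O.
Proof.
elim/(well_founded_ind ord_lt_wf): c => c IH; apply: oadd_le.
  by rewrite (le_trans (le_oadd a b))// le_oadd.
move=> x xbc; have [xb|bx] := ltP x b.
  by rewrite (@lt_le_trans _ _ (oadd a b)) ?oadd_lt// le_oadd.
(* If x were strictly above every b + d with d < c, then, as b <= x, [oadd_le] would give b + c <=
   x. *)
have [d [dc xd]] : exists d, (d < c)%O /\ (x <= oadd b d)%O.
  apply: contrapT => nd; move: xbc; rewrite ltNge => /negP; apply.
  apply: oadd_le => // d dc; rewrite ltNge; apply/negP => xd.
  by apply: nd; exists d.
rewrite (@le_lt_trans _ _ (oadd a (oadd b d))) ?oadd_le_mono//.
by rewrite (le_lt_trans (IH d dc))// oadd_lt.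
Qed.

Lemma oadd0l x : oadd ozero x = x.
Proof.
elim/(well_founded_ind ord_lt_wf): x => x IH; apply/le_anti/andP; split.
  by apply: oadd_le => [|y yx]; rewrite ?ozero_le ?IH.
(* If y = 0 + x were below x, then 0 + y = y by induction, while strict monotonicity gives 0 + y < 0
   + x = y. *)
rewrite leNgt; apply/negP => /[dup] xx /IH; move: xx => /(oadd_lt ozero).
by move=> /[swap] ->; rewrite ltxx.
Qed.

(** * Finite multiples and powers of omega *)

Lemma onatS n : onat n.+1 = osucc (onat n). Proof. by []. Qed.

Lemma omul_onatS w n : omul w (onat n.+1) = oadd (omul w (onat n)) w.
Proof. exact: omulS. Qed.

Lemma omul_onat_mono w m n : (m <= n)%N ->
  (omul w (onat m) <= omul w (onat n))%O.
Proof.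
elim: n => [|n IH]; first by rewrite leqn0 => /eqP ->.
rewrite leq_eqVlt => /orP[/eqP -> //|mn].
by rewrite omul_onatS (le_trans (IH mn))// le_oadd.
Qed.

Lemma omega_supremums : supremums (range onat) !=set0.
Proof. exact: small_supremums. Qed.

Lemma onat_lt_omega n : (onat n < omega)%O.
Proof.
apply: (@lt_le_trans _ _ (onat n.+1)); first exact: osucc_gt.
by apply: supremum_ub; [exact: omega_supremums|exists n.+1].
Qed.

Lemma lt_omegaP x : (x < omega)%O -> exists n, x = onat n.
Proof.
move=> xo; apply: contrapT => nx; move: xo; rewrite ltNge => /negP; apply.
apply: supremum_le; first exact: omega_supremums.
move=> _ [n _ <-]; elim: n => [|n IH]; first exact: ozero_le.
rewrite onatS osucc_le lt_neqAle IH andbT; apply/eqP => xn; apply: nx.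
by exists n.
Qed.

Lemma omega_limit : is_limit omega.
Proof.
split; first by rewrite gt_eqF// (onat_lt_omega 0).
move=> b ob; have /lt_omegaP[n bn] : (b < omega)%O by rewrite ob osucc_gt.
by have := onat_lt_omega n.+1; rewrite ob bn onatS ltxx.
Qed.

Lemma omegaXS xi : omegaX (osucc xi) = omul (omegaX xi) omega.
Proof. exact: oexpS. Qed.

Lemma lt_omegaXS_P xi x : (x < omegaX (osucc xi))%O ->
  exists n, (x < omul (omegaX xi) (onat n))%O.
Proof.
rewrite omegaXS (omulL _ omega_limit) => xo; apply: contrapT => nx.
move: xo; rewrite ltNge => /negP; apply; apply: osup_le => _ /lt_omegaP[n ->].
by rewrite leNgt; apply/negP => xn; apply: nx; exists n.
Qed.

Lemma omul_le_omegaXS xi n : (omul (omegaX xi) (onat n) <= omegaX (osucc xi))%O.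
Proof.
rewrite omegaXS (omulL _ omega_limit); apply: osup_ub; exact: onat_lt_omega.
Qed.

Lemma omegaX_leS xi : (omegaX xi <= omegaX (osucc xi))%O.
Proof. by have := omul_le_omegaXS xi 1; rewrite omul_onatS omul0 oadd0l. Qed.

Lemma omegaX_mono zeta xi : (zeta <= xi)%O -> (omegaX zeta <= omegaX xi)%O.
Proof.
elim/(well_founded_ind ord_lt_wf): xi => xi IH.
rewrite le_eqVlt => /orP[/eqP -> //|zx].
case: (ord_cases xi) => [x0|[d xd]|xl].
- by move: zx; rewrite x0 ltNge ozero_le.
- move: zx; rewrite xd lt_osucc => zd.
  by rewrite (le_trans _ (omegaX_leS d))// IH// xd osucc_gt.
- by rewrite {2}/omegaX (oexpL _ xl); exact: osup_ub.
Qed.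

Lemma omegaX_gt0 xi : (ozero < omegaX xi)%O.
Proof.
rewrite (@lt_le_trans _ _ (omegaX ozero)) ?omegaX_mono ?ozero_le//.
by rewrite /omegaX oexp0 osucc_gt.
Qed.

Lemma oadd_leL a b c : (a <= b)%O -> (oadd a c <= oadd b c)%O.
Proof.
move=> ab; elim/(well_founded_ind ord_lt_wf): c => c IH.
apply: oadd_le => [|x xc]; first exact/(le_trans ab)/le_oadd.
by rewrite (le_lt_trans (IH x xc))// oadd_lt.
Qed.

Lemma oadd_omul_le w n : (oadd w (omul w (onat n)) <= omul w (onat n.+1))%O.
Proof.
elim: n => [|n IH]; first by rewrite omul_onatS omul0 oadd0 oadd0l.
by rewrite omul_onatS (le_trans (oadd_assoc_le _ _ _))// omul_onatS oadd_leL.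
Qed.

(** An x below omega^(xi+1) is below some omega^xi n, and omega^xi + omega^xi n <= omega^xi (n+1).
    This keeps the piece omega^zeta + Gamma_{zeta+1} of a limit tree below omega^(zeta+1). *)
Lemma oadd_omegaX_lt xi x : (x < omegaX (osucc xi))%O ->
  (oadd (omegaX xi) x < omegaX (osucc xi))%O.
Proof.
move=> /lt_omegaXS_P[n xn].
rewrite (@lt_le_trans _ _ (omul (omegaX xi) (onat n.+1))) ?omul_le_omegaXS//.
by rewrite (lt_le_trans _ (oadd_omul_le _ n))// oadd_lt.
Qed.

(** * Structure of the trees *)

Lemma shift_inj z : injective (shift z).
Proof. exact/inj_map/oadd_inj. Qed.

Lemma prefix_shift z s t : prefix (shift z s) (shift z t) = prefix s t.
Proof.
elim: s t => [|x s IH] [|y t] //=.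
by rewrite (inj_eq (oadd_inj z)); case: eqP => //= _; exact: IH.
Qed.

Lemma prefix_shiftP z u t : prefix u (shift z t) ->
  exists2 s, prefix s t & u = shift z s.
Proof.
move=> /prefixP[r tr]; exists (take (size u) t); first exact: prefix_take.
by rewrite /shift map_take -/(shift z t) tr take_size_cat.
Qed.

Lemma proper_prefix_shift z s t :
  proper_prefix (shift z s) (shift z t) = proper_prefix s t.
Proof. by rewrite /proper_prefix prefix_shift (inj_eq (@shift_inj z)). Qed.

Lemma MAX_shift z G : MAX (shift z @` G) = shift z @` MAX G.
Proof.
apply/seteqP; split=> [_ [[t Gt <-] tmax]|_ [t [Gt tmax] <-]].
  exists t => //; split=> // u Gu tu; apply: (@shift_inj z); apply: tmax.
    by exists u.
  by rewrite prefix_shift.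
split; first by exists t.
by move=> _ [u Gu <-]; rewrite prefix_shift => tu; rewrite (tmax u).
Qed.

Lemma prefix_cat2l (s t u : seq Ord) : prefix (s ++ t) (s ++ u) = prefix t u.
Proof. by rewrite prefix_catr// eqxx. Qed.

Lemma prefix_catP {s t u : seq Ord} : prefix s (t ++ u) ->
  prefix s t \/ exists2 v, prefix v u & s = t ++ v.
Proof.
rewrite prefixE take_cat; case: ifP => _ /eqP sE.
  by left; rewrite -sE prefix_take.
by right; exists (take (size s - size t) u); first exact: prefix_take.
Qed.

(** The hypothesis asks for more than disjointness: sequences from different pieces are not even
    comparable. Hence an extension within the union stays in the same piece. *)
Lemma MAX_bigcup {T} {I : set T} {S : T -> set (seq Ord)} :
  (forall i j s t, I i -> I j -> S i s -> S j t -> prefix s t -> i = j) ->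
  MAX (\bigcup_(i in I) S i) = \bigcup_(i in I) MAX (S i).
Proof.
move=> disj; apply/seteqP; split=> [t [[i Ii Sit] tmax]|t [i Ii [Sit tmax]]].
  by exists i => //; split=> // u Siu; apply: tmax; exists i.
split; first by exists i.
by move=> u [j Ij Sju] tu; apply: tmax => //; rewrite (disj i j t u).
Qed.

(** * The trees Gamma_{xi,n} and their leaves *)

Definition wn (xi : Ord) (n : nat) : Ord := omul (omegaX xi) (onat n).

Lemma wnS xi n : wn xi n.+1 = oadd (wn xi n) (omegaX xi).
Proof. exact: omul_onatS. Qed.

Lemma wn0 xi : wn xi 0 = ozero.
Proof. exact: omul0. Qed.

Lemma shift0 t : shift ozero t = t.
Proof. by elim: t => //= x t ->; rewrite oadd0l. Qed.

(** As Gamma_{xi,0} is empty by convention and [wn xi 0] is zero, the recursion also holds at n = 0,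
    so inductions on n can start from the empty tree. *)
Lemma Gamma_nE xi n : Gamma_n xi n.+1 =
  shift (wn xi n) @` Gamma xi `|`
  [set shift (wn xi n) t ++ u | t in MAX (Gamma xi) & u in Gamma_n xi n].
Proof.
case: n => [|n].
  rewrite wn0 (_ : shift ozero = id); last by apply/funext; exact: shift0.
  rewrite image_id [X in _ `|` X](_ : _ = set0) ?setU0//.
  by apply/seteqP; split=> // _ [t _ [u []]].
rewrite Gamma_nS// MAX_shift; congr (_ `|` _).
apply/seteqP; split=> [_ [_ [t tM <-] [u uG <-]]|_ [t tM [u uG <-]]].
  by exists t => //; exists u.
by exists (shift (wn xi n.+1) t); [exists t|exists u].
Qed.

Lemma Gamma_n_shift {xi n t} :
  Gamma xi t -> Gamma_n xi n.+1 (shift (wn xi n) t).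
Proof. by move=> Gt; rewrite Gamma_nE; left; exists t. Qed.

Lemma Gamma_n_cat {xi n t u} : MAX (Gamma xi) t -> Gamma_n xi n u ->
  Gamma_n xi n.+1 (shift (wn xi n) t ++ u).
Proof. by move=> Gt Gu; rewrite Gamma_nE; right; exists t => //; exists u. Qed.

Variant Gamma_n_spec xi n : seq Ord -> Prop :=
| GammaNShift t of Gamma xi t : Gamma_n_spec xi n (shift (wn xi n) t)
| GammaNCat t u of MAX (Gamma xi) t & Gamma_n xi n u :
    Gamma_n_spec xi n (shift (wn xi n) t ++ u).

Lemma Gamma_nP {xi n x} : Gamma_n xi n.+1 x -> Gamma_n_spec xi n x.
Proof.
by rewrite Gamma_nE => -[[t Gt <-]|[t Mt [u Gu <-]]];
  [exact: GammaNShift|exact: GammaNCat].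
Qed.

(** The bound [w] on the entries is what tells shifted copies apart, and [tree_leaf] is what allows
    images of nodes to be continued to leaves. *)
Record is_tree (w : Ord) (S : set (seq Ord)) : Prop := IsTree {
  tree_neq0 : forall t, S t -> t != [::];
  tree_lt : forall t x, S t -> x \in t -> (x < w)%O;
  tree_prefix : forall {s t}, S t -> prefix s t -> s != [::] -> S s;
  tree_leaf : forall {s}, S s -> exists2 t, MAX S t & prefix s t }.

Section GammaN.
Variables (xi : Ord).
Hypotheses (treeG : is_tree (omegaX xi) (Gamma xi)) (Gneq0 : Gamma xi !=set0).

Lemma Gamma_n_lt n t x : Gamma_n xi n t -> x \in t -> (x < wn xi n)%O.
Proof.
elim: n t => // n IH t /Gamma_nP[{}t Gt|{}t u [Gt _] Gu].
  by move=> /mapP[y yt ->]; rewrite wnS oadd_lt// (tree_lt _ _ treeG t).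
rewrite mem_cat => /orP[/mapP[y yt ->]|xu].
  by rewrite wnS oadd_lt// (tree_lt _ _ treeG t).
by rewrite (@lt_le_trans _ _ (wn xi n)) ?(IH u)// wnS le_oadd.
Qed.

Lemma Gamma_n_neq0 n t : Gamma_n xi n t -> t != [::].
Proof.
case: n => // n /Gamma_nP[{}t Gt|{}t u [Gt _] Gu];
  by have := tree_neq0 _ _ treeG t Gt; case: (t).
Qed.

Lemma MAX_Gamma_neq0 : MAX (Gamma xi) !=set0.
Proof.
by have [t Gt] := Gneq0; have [u Mu _] := tree_leaf _ _ treeG Gt; exists u.
Qed.

(* The two halves of an element [shift (wn xi n) t ++ u] of Gamma_{xi,n+1} are
   recognised by the size of their entries: those of the first half are at least
   omega^xi n, those of [u] are below it. *)
Definition hd n (x : seq Ord) : seq Ord :=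
  xget [::] [set t | shift (wn xi n) t = [seq y <- x | (wn xi n <= y)%O]].
Definition tl n (x : seq Ord) : seq Ord := [seq y <- x | (y < wn xi n)%O].

Lemma filter_ge_shift n t :
  [seq y <- shift (wn xi n) t | (wn xi n <= y)%O] = shift (wn xi n) t.
Proof. by apply/all_filterP/allP => _ /mapP[y _ ->]; exact: le_oadd. Qed.

Lemma filter_ge_Gamma_n n u : Gamma_n xi n u ->
  [seq y <- u | (wn xi n <= y)%O] = [::].
Proof.
move=> Gu; apply/eqP; rewrite -[_ == _]negbK -has_filter.
by apply/hasPn => y /(Gamma_n_lt _ _ _ Gu); rewrite -ltNge.
Qed.

Lemma hd_cat n t u : (u = [::] \/ Gamma_n xi n u) ->
  hd n (shift (wn xi n) t ++ u) = t.
Proof.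
move=> uE; rewrite /hd filter_cat filter_ge_shift.
rewrite (_ : filter _ u = [::]) ?cats0; last first.
  by case: uE => [->//|]; exact: filter_ge_Gamma_n.
by case: xgetP => [s _ /= /shift_inj|/(_ t)/(_ erefl)].
Qed.

Lemma hd_shift n t : hd n (shift (wn xi n) t) = t.
Proof. by rewrite -[X in hd n X]cats0 hd_cat//; left. Qed.

Lemma tl_shift n t : tl n (shift (wn xi n) t) = [::].
Proof.
apply/eqP; rewrite -[_ == _]negbK -has_filter.
by apply/hasPn => _ /mapP[y _ ->]; rewrite -leNgt le_oadd.
Qed.

Lemma tl_cat n t u : Gamma_n xi n u -> tl n (shift (wn xi n) t ++ u) = u.
Proof.
move=> Gu; rewrite /tl filter_cat -!/(tl _ _) tl_shift cat0s.
by apply/all_filterP/allP => y; exact: Gamma_n_lt.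
Qed.

Lemma prefix_tl n s t : prefix s t -> prefix (tl n s) (tl n t).
Proof. by move=> /prefixP[r ->]; rewrite /tl filter_cat prefix_prefix. Qed.

Lemma shift_hd n x : Gamma_n xi n.+1 x ->
  shift (wn xi n) (hd n x) = [seq y <- x | (wn xi n <= y)%O].
Proof.
move=> /Gamma_nP[t Gt|t u Mt Gu]; first by rewrite hd_shift filter_ge_shift.
rewrite hd_cat; last by right.
by rewrite filter_cat filter_ge_shift filter_ge_Gamma_n// cats0.
Qed.

Lemma prefix_hd n x y : Gamma_n xi n.+1 x -> Gamma_n xi n.+1 y -> prefix x y ->
  prefix (hd n x) (hd n y).
Proof.
move=> Gx Gy /prefixP[r yE]; rewrite -(prefix_shift (wn xi n)) !shift_hd//.
by rewrite yE filter_cat prefix_prefix.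
Qed.

Variant prefix_spec n : seq Ord -> seq Ord -> Prop :=
| PrefShift s t of Gamma xi s & Gamma xi t & prefix s t :
    prefix_spec n (shift (wn xi n) s) (shift (wn xi n) t)
| PrefMix s t u of Gamma xi s & MAX (Gamma xi) t & Gamma_n xi n u & prefix s t :
    prefix_spec n (shift (wn xi n) s) (shift (wn xi n) t ++ u)
| PrefCat t u v of MAX (Gamma xi) t & Gamma_n xi n u & Gamma_n xi n v
    & prefix u v :
    prefix_spec n (shift (wn xi n) t ++ u) (shift (wn xi n) t ++ v).

Lemma Gamma_n_prefixP n x y : Gamma_n xi n.+1 x -> Gamma_n xi n.+1 y ->
  prefix x y -> prefix_spec n x y.
Proof.
move=> Gx Gy xy; have := prefix_tl n _ _ xy; have := prefix_hd _ _ _ Gx Gy xy.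
move: Gx Gy {xy} => /Gamma_nP[s Gs|s u Ms Gu] /Gamma_nP[t Gt|t v Mt Gv].
- by rewrite !hd_shift => st _; exact: PrefShift.
- by rewrite hd_shift hd_cat; [move=> st _; exact: PrefMix|right].
(* A member with a nonempty tail cannot be a prefix of one with an empty tail. *)
- rewrite tl_cat// tl_shift prefixs0 => _ /eqP u0.
  by have := Gamma_n_neq0 _ _ Gu; rewrite u0.
(* Both heads are leaves, so comparability makes them equal. *)
- rewrite !tl_cat// !hd_cat; [|by right..].
  by case: (Ms) (Mt) => _ ms [Gt _] /(ms _ Gt) -> uv; exact: PrefCat.
Qed.

(** A member without an upper part is never maximal, because a leaf above it can be continued into
    the nonempty Gamma_{xi,n}. For n = 0 the right side would be empty, hence the hypothesis. *)
Lemma MAX_Gamma_nS n : Gamma_n xi n !=set0 ->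
  MAX (Gamma_n xi n.+1) =
  [set shift (wn xi n) t ++ u | t in MAX (Gamma xi) & u in MAX (Gamma_n xi n)].
Proof.
move=> [u0 Gu0]; apply/seteqP; split; last first.
  move=> _ [t Mt [u [Gu mu] <-]]; split; first exact: Gamma_n_cat.
  move=> y Gy xy; have := prefix_tl n _ _ xy.
  have := prefix_hd _ _ _ (Gamma_n_cat Mt Gu) Gy xy.
  rewrite tl_cat// hd_cat; last by right.
  case: (Gamma_nP Gy) => [s Gs|s v [Gs ms] Gv].
    rewrite tl_shift prefixs0 => _ /eqP u0E.
    by have := Gamma_n_neq0 _ _ Gu; rewrite u0E.
  rewrite tl_cat// hd_cat; last by right.
  by case: Mt => _ mt /(mt _ Gs) -> /(mu _ Gv) ->.
move=> x [/Gamma_nP[t Gt|t u Mt Gu] mx]; last first.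
  exists t => //; exists u => //; split=> // v Gv uv.
  have := mx _ (Gamma_n_cat Mt Gv); rewrite prefix_cat2l => /(_ uv).
  by move=> /(congr1 (tl n)); rewrite !tl_cat.
have [s Ms ts] := tree_leaf _ _ treeG Gt.
have := mx _ (Gamma_n_cat Ms Gu0).
rewrite prefix_catl ?prefix_shift// => /(_ isT).
move=> /(congr1 (tl n)); rewrite tl_cat// tl_shift => u0E.
by have := Gamma_n_neq0 _ _ Gu0; rewrite u0E.
Qed.

Lemma Gamma_n_nonempty n : (0 < n)%N -> Gamma_n xi n !=set0.
Proof.
case: n => // n _; have [t Gt] := Gneq0.
by exists (shift (wn xi n) t); exact: Gamma_n_shift.
Qed.

Lemma Gamma_n_tree n : is_tree (wn xi n) (Gamma_n xi n).
Proof.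
split; [exact: Gamma_n_neq0|exact: Gamma_n_lt| |].
  elim: n => // n IH s x /Gamma_nP[t Gt|t u Mt Gu].
    move=> /prefix_shiftP[{}s st ->] s0; apply: Gamma_n_shift.
    by apply: (tree_prefix _ _ treeG Gt st); case: (s) s0.
  move=> /prefix_catP[/prefix_shiftP[{}s st ->] s0|[v vu ->] _].
    by apply: Gamma_n_shift; case: Mt => Gt _;
      apply: (tree_prefix _ _ treeG Gt st); case: (s) s0.
  have [->|v0] := eqVneq v [::].
    by rewrite cats0; apply: Gamma_n_shift; case: Mt.
  by apply: Gamma_n_cat => //; exact: IH vu v0.
elim: n => // n IH s Gs; case: n IH Gs => [_|n IH].
  by rewrite Gamma_n1; exact: (tree_leaf _ _ treeG).
rewrite MAX_Gamma_nS; last exact: Gamma_n_nonempty.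
move=> /Gamma_nP[t Gt|t u Mt Gu].
  have [t' Mt' tt'] := tree_leaf _ _ treeG Gt.
  have [u0 /IH[u Mu _]] := Gamma_n_nonempty n.+1 isT.
  exists (shift (wn xi n.+1) t' ++ u); first by exists t' => //; exists u.
  by rewrite prefix_catl// prefix_shift.
have [v Mv uv] := IH u Gu.
exists (shift (wn xi n.+1) t ++ v); first by exists t => //; exists v.
by rewrite prefix_cat2l.
Qed.

(** The first entry of a member of Gamma_{xi,n} is at least omega^xi (n-1) and below omega^xi n;
    these intervals are disjoint, and a nonempty prefix shares the first entry. *)
Lemma Gamma_n_disj m n s t : Gamma_n xi m s -> Gamma_n xi n t -> prefix s t ->
  m = n.
Proof.
have key m' n' s' t' : (m' < n')%N -> Gamma_n xi m' s' -> Gamma_n xi n' t' ->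
    head ozero s' <> head ozero t'.
  case: n' => // n' mn Gs Gt.
  have : (head ozero s' < wn xi n')%O.
    rewrite (@lt_le_trans _ _ (wn xi m')) ?omul_onat_mono//.
    apply: (Gamma_n_lt _ _ _ Gs).
    by have := Gamma_n_neq0 _ _ Gs; case: (s') => // x ? _; rewrite mem_head.
  suff : (wn xi n' <= head ozero t')%O.
    by move=> + + e; rewrite e leNgt => /negP.
  move: Gt => /Gamma_nP[{}t' Gt|{}t' u [Gt _] _];
  by have := tree_neq0 _ _ treeG _ Gt; case: (t') => //= x ? _; exact: le_oadd.
move=> Gs Gt /prefixP[r tE].
have hst : head ozero s = head ozero t.
  by rewrite tE; have := Gamma_n_neq0 _ _ Gs; case: (s).
by case: (ltngtP m n) => // mn;
  [have := key _ _ _ _ mn Gs Gt|have := key _ _ _ _ mn Gt Gs]; rewrite hst.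
Qed.

End GammaN.

(** * The trees Gamma_xi for all xi *)

Lemma is_tree_shift w w' z S : (forall x, (x < w)%O -> (oadd z x < w')%O) ->
  is_tree w S -> is_tree w' (shift z @` S).
Proof.
move=> zw [S0 Slt Spre Sleaf]; split.
- by move=> _ [t St <-]; have := S0 t St; case: (t).
- by move=> _ x [t St <-] /mapP[y yt ->]; exact/zw/(Slt t).
- move=> s _ [t St <-] /prefix_shiftP[{}s st ->] s0; exists s => //.
  by apply: (Spre s t) => //; case: (s) s0.
- move=> _ [t St <-]; have [u Mu tu] := Sleaf t St.
  by exists (shift z u); rewrite ?prefix_shift// MAX_shift; exists u.
Qed.

Lemma is_tree_bigcup T (I : set T) (S : T -> set (seq Ord)) (v : T -> Ord) w :
  (forall i j s t, I i -> I j -> S i s -> S j t -> prefix s t -> i = j) ->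
  (forall i, I i -> (v i <= w)%O) ->
  (forall i, I i -> is_tree (v i) (S i)) -> is_tree w (\bigcup_(i in I) S i).
Proof.
move=> disj vw tS; split.
- by move=> t [i Ii]; exact: tree_neq0 (tS i Ii) t.
- move=> t x [i Ii St] xt; rewrite (@lt_le_trans _ _ (v i)) ?vw//.
  exact: tree_lt (tS i Ii) t x St xt.
- move=> s t [i Ii St] st s0; exists i => //.
  exact: (tree_prefix _ _ (tS i Ii) St st).
- move=> s [i Ii Ss]; have [t Mt st] := tree_leaf _ _ (tS i Ii) Ss.
  by exists t => //; rewrite (MAX_bigcup disj); exists i.
Qed.

(** First entries decide again: those of the piece at [zeta] are at least omega^zeta and below
    omega^(zeta+1). The tree hypotheses are explicit because the induction that establishes them
    uses this lemma. *)
Lemma limit_disj zeta eta s t :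
  is_tree (omegaX (osucc zeta)) (Gamma (osucc zeta)) ->
  is_tree (omegaX (osucc eta)) (Gamma (osucc eta)) ->
  (shift (omegaX zeta) @` Gamma (osucc zeta)) s ->
  (shift (omegaX eta) @` Gamma (osucc eta)) t -> prefix s t -> zeta = eta.
Proof.
have key z e s' t' : (z < e)%O ->
    is_tree (omegaX (osucc z)) (Gamma (osucc z)) ->
    s' != [::] -> t' != [::] -> Gamma (osucc z) s' ->
    head ozero (shift (omegaX z) s') <> head ozero (shift (omegaX e) t').
  move=> ze tz + + Gs; case: s' Gs => // x s' Gs _; case: t' => // y t' _ /= xy.
  have : (oadd (omegaX z) x < omegaX (osucc z))%O.
    by apply: oadd_omegaX_lt; apply: (tree_lt _ _ tz _ _ Gs); rewrite mem_head.
  apply/negP; rewrite -leNgt xy.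
  by rewrite (le_trans _ (le_oadd _ _))// omegaX_mono// osucc_le.
move=> tz te [{}s Gs <-] [{}t Gt <-] /prefixP[r tE].
have s0 := tree_neq0 _ _ tz _ Gs; have t0 := tree_neq0 _ _ te _ Gt.
have hst : head ozero (shift (omegaX zeta) s) =
           head ozero (shift (omegaX eta) t).
  by rewrite tE; case: (s) s0.
have [ze|ez|//] := ltgtP zeta eta.
  by have := key _ _ _ _ ze tz s0 t0 Gs.
by have := key _ _ _ _ ez te t0 s0 Gt; rewrite hst.
Qed.

(** The two properties are proved jointly, since at a successor the tree property of the Gamma_{z,n}
    rests on Gamma_z being nonempty. *)
Lemma Gamma_tree_neq0 xi : is_tree (omegaX xi) (Gamma xi) /\ Gamma xi !=set0.
Proof.
elim/(well_founded_ind ord_lt_wf): xi => xi IH.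
case: (ord_cases xi) => [->|[z xz]|xl].
- rewrite Gamma0; split; last by exists [:: ozero].
  split=> [_ -> //|_ x ->||_ ->].
  + by rewrite inE => /eqP ->; exact: omegaX_gt0.
  + by move=> s _ ->; rewrite prefixs1 => /orP[/eqP ->//|/eqP ->].
  + by exists [:: ozero]; [split=> // u ->|exact: prefix_refl].
- have [tz nz] : is_tree (omegaX z) (Gamma z) /\ Gamma z !=set0.
    by apply: IH; rewrite xz osucc_gt.
  rewrite xz GammaS; split; last first.
    by have [t Gt] := nz; exists t; exists 1%N.
  apply: (@is_tree_bigcup _ _ _ (wn z)).
  + by move=> i j s t _ _; exact: Gamma_n_disj.
  + by move=> i _; exact: omul_le_omegaXS.
  + by move=> i _; exact: Gamma_n_tree.
- rewrite (GammaL xl); split; last first.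
    have l1 : (osucc ozero < xi)%O.
      by apply: limit_osucc => //; exact: limit_gt0.
    have [_ [t Gt]] := IH _ l1; exists (shift (omegaX ozero) t).
    by exists ozero; [exact: limit_gt0|exists t].
  apply: (@is_tree_bigcup _ _ _ (fun z => omegaX (osucc z))).
  + move=> i j s t ix jx; apply: limit_disj.
      by have [] := IH _ (limit_osucc xl ix).
    by have [] := IH _ (limit_osucc xl jx).
  + by move=> z zx; rewrite omegaX_mono// osucc_le.
  + move=> z zx; apply: (@is_tree_shift (omegaX (osucc z))).
      by move=> x; exact: oadd_omegaX_lt.
    by have [] := IH _ (limit_osucc xl zx).
Qed.

Lemma Gamma_tree xi : is_tree (omegaX xi) (Gamma xi).
Proof. by have [] := Gamma_tree_neq0 xi. Qed.

Lemma Gamma_neq0 xi : Gamma xi !=set0.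
Proof. by have [] := Gamma_tree_neq0 xi. Qed.

(** * Decompositions, levels and probabilities *)

Lemma decompositionS xi n x t ts : decomposition xi n.+1 x (t :: ts) <->
  [/\ ts = [::], Gamma xi t & x = shift (wn xi n) t] \/
  MAX (Gamma xi) t /\
    exists2 u, decomposition xi n u ts & x = shift (wn xi n) t ++ u.
Proof.
(* [F m s] concatenates the blocks with offsets counted down from m; removing the first block turns
   the offsets for n + 1 into those for n. *)
pose F m (s : seq (seq Ord)) := flatten (mkseq (fun i =>
  shift (omul (omegaX xi) (onat (m - i.+1))) (nth [::] s i)) (size s)).
have FS : F n.+1 (t :: ts) = shift (wn xi n) t ++ F n ts.
  rewrite /F /mkseq /= subSS subn0; congr (_ ++ flatten _).
  rewrite -[1%N]addn0 iotaDl -map_comp; apply: eq_map => i /=.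
  by rewrite subSS.
split.
  move=> [sz GG MM xE]; rewrite -/(F n.+1 (t :: ts)) FS in xE.
  case: ts sz GG MM xE {FS} => [|t' ts] sz GG MM xE.
    by left; split => //; [exact: (GG 0%N)|rewrite xE /F /= cats0].
  right; split; first exact: (MM 0%N).
  exists (F n (t' :: ts)) => //; split => // i it; first exact: (GG i.+1).
  exact: (MM i.+1).
case=> [[-> Gt ->]|[Mt [u [sz GG MM uE] ->]]].
  split=> //; first by case.
  by rewrite /= /mkseq /= cats0 subSS subn0.
rewrite -/(F n ts) in uE; split => //.
- by case/andP: sz.
- by case=> [|i] //=; [case: Mt|exact: GG].
- by case=> [|i] //=; exact: MM.
- by rewrite -/(F n.+1 (t :: ts)) FS uE.
Qed.

Lemma decomposition0 xi x ts : ~ decomposition xi 0 x ts.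
Proof. by case=> /andP[s1 s2]; have := leq_trans s1 s2. Qed.

Lemma decomposition_nil xi n x : ~ decomposition xi n x [::].
Proof. by case. Qed.

Lemma decomposition_Gamma_n xi n x ts :
  decomposition xi n x ts -> Gamma_n xi n x.
Proof.
elim: n x ts => [|n IH] x [|t ts];
  do ?[by move=> /decomposition_nil|by move=> /decomposition0].
by move=> /decompositionS[[_ Gt ->]|[Mt [u /IH Gu ->]]];
  [exact: Gamma_n_shift|exact: Gamma_n_cat].
Qed.

(** [hd] and [tl] recover the first block and the rest, and the rest is empty exactly when there is
    a single block. *)
Lemma decomposition_uniq xi n x ts ts' :
  decomposition xi n x ts -> decomposition xi n x ts' -> ts = ts'.
Proof.
elim: n x ts ts' => [|n IH] x [|t ts] [|t' ts'] //;
  do ?[by move=> /decomposition_nil|by move=> /decomposition0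
      |by move=> _ /decomposition_nil].
have T := Gamma_tree xi.
move=> /decompositionS[[-> Gt ->]|[Mt [u du ->]]].
  move=> /decompositionS[[-> Gt' /shift_inj -> //]|[Mt' [u' du']]].
  move=> /(congr1 (tl xi n)); rewrite tl_shift tl_cat//; last first.
    exact: decomposition_Gamma_n du'.
  move=> u0.
  have := Gamma_n_neq0 xi T n _ (decomposition_Gamma_n _ _ _ _ du').
  by rewrite -u0.
have Gu := decomposition_Gamma_n _ _ _ _ du.
move=> /decompositionS[[-> Gt']|[Mt' [u' du']]].
  move=> /(congr1 (tl xi n)); rewrite tl_shift tl_cat//.
  by move=> u0; have := Gamma_n_neq0 xi T n _ Gu; rewrite u0.
have Gu' := decomposition_Gamma_n _ _ _ _ du'.
move=> xx; have := congr1 (tl xi n) xx; have := congr1 (hd xi n) xx.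
rewrite !hd_cat//; [|by right..]; rewrite !tl_cat// => -> uu.
by rewrite -uu in du'; rewrite (IH _ _ _ du du').
Qed.

Definition iotas xi n x : seq (seq Ord) :=
  xget [::] [set ts | decomposition xi n x ts].

(** Counted from 0, so level m in the sense of [Lambda] is [m.-1] here. *)
Definition level xi n x : nat := (size (iotas xi n x)).-1.

Lemma iotasE xi n x ts : decomposition xi n x ts -> iotas xi n x = ts.
Proof.
by move=> d; apply: xget_unique => // ts' d'; exact: decomposition_uniq d' d.
Qed.

Lemma iotas_shift {xi n t} : Gamma xi t ->
  iotas xi n.+1 (shift (wn xi n) t) = [:: t].
Proof. by move=> Gt; apply: iotasE; apply/decompositionS; left. Qed.

Lemma decomposition_iotas {xi n x} : Gamma_n xi n x ->
  decomposition xi n x (iotas xi n x).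
Proof.
elim: n x => // n IH x /Gamma_nP[t Gt|t u Mt /IH du].
  by rewrite iotas_shift//; apply/decompositionS; left.
have dt : decomposition xi n.+1 (shift (wn xi n) t ++ u) (t :: iotas xi n u).
  by apply/decompositionS; right; split=> //; exists u.
by rewrite (iotasE _ _ _ _ dt).
Qed.

Lemma iotas_cat {xi n t u} : MAX (Gamma xi) t -> Gamma_n xi n u ->
  iotas xi n.+1 (shift (wn xi n) t ++ u) = t :: iotas xi n u.
Proof.
move=> Mt Gu; apply: iotasE; apply/decompositionS; right; split=> //.
by exists u => //; exact: decomposition_iotas.
Qed.

Lemma iotas_neq0 {xi n x} : Gamma_n xi n x -> iotas xi n x != [::].
Proof.
by move=> Gx; apply/eqP => x0; have := decomposition_iotas Gx;
  rewrite x0 => /decomposition_nil.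
Qed.

Lemma level_lt {xi n x} : Gamma_n xi n x -> (level xi n x < n)%N.
Proof.
by move=> /decomposition_iotas[/andP[s1 s2] _ _ _]; rewrite /level prednK.
Qed.

Lemma level_shift {xi n t} : Gamma xi t ->
  level xi n.+1 (shift (wn xi n) t) = 0%N.
Proof. by move=> Gt; rewrite /level iotas_shift. Qed.

Lemma level_cat {xi n t u} : MAX (Gamma xi) t -> Gamma_n xi n u ->
  level xi n.+1 (shift (wn xi n) t ++ u) = (level xi n u).+1.
Proof.
move=> Mt Gu; rewrite /level iotas_cat//.
by have := iotas_neq0 Gu; case: iotas.
Qed.

Lemma level_Lambda xi n m x : Lambda xi n m.+1 x -> level xi n x = m.
Proof. by move=> [_ [ts d sz]]; rewrite /level (iotasE _ _ _ _ d) sz. Qed.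

Section Prob.
Variable R : realType.

Lemma prob_n_shift {xi n t} : Gamma xi t ->
  prob_n R xi n.+1 (shift (wn xi n) t) = prob R xi t.
Proof. by move=> Gt; rewrite /prob_n /iota_n -/(iotas _ _ _) iotas_shift. Qed.

Lemma prob_n_cat {xi n t u} : MAX (Gamma xi) t -> Gamma_n xi n u ->
  prob_n R xi n.+1 (shift (wn xi n) t ++ u) = prob_n R xi n u.
Proof.
move=> Mt Gu; rewrite /prob_n /iota_n -!/(iotas _ _ _) iotas_cat//.
by have := iotas_neq0 Gu; case: iotas.
Qed.

(** Since the trees Gamma_{xi,n} are pairwise disjoint, the index chosen in [probS] can only be
    n. *)
Lemma prob_succ {xi n s} : (0 < n)%N -> Gamma_n xi n s ->
  prob R (osucc xi) s = n%:R^-1 * prob_n R xi n s.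
Proof.
move=> n0 Gs; rewrite probS /= (_ : xget _ _ = n)//.
apply: xget_unique => // m [_ Gm].
exact: (Gamma_n_disj xi (Gamma_tree xi) _ _ _ _ Gm Gs (prefix_refl s)).
Qed.

Lemma prob_limit {xi zeta t} : is_limit xi -> (zeta < xi)%O ->
  Gamma (osucc zeta) t ->
  prob R xi (shift (omegaX zeta) t) = prob R (osucc zeta) t.
Proof.
move=> xl zx Gt; rewrite (probL _ _ xl) /= (_ : xget _ _ = (zeta, t))//.
apply: xget_unique => // -[eta s] [/= ex Gs e].
have /esym ze : zeta = eta.
  apply: (@limit_disj zeta eta (shift (omegaX zeta) t) (shift (omegaX eta) s));
    [exact: Gamma_tree|exact: Gamma_tree|by exists t|by exists s|].
  by rewrite e prefix_refl.
by subst eta; rewrite (shift_inj _ _ _ e).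
Qed.

End Prob.

(** * Monotone maps *)

Definition embeds (S T : set (seq Ord)) (j : seq Ord -> seq Ord) : Prop :=
  set_fun S T j /\
  forall s t, S s -> S t -> proper_prefix s t -> proper_prefix (j s) (j t).

Lemma embeds_id S T : S `<=` T -> embeds S T id.
Proof. by move=> ST; split. Qed.

Lemma embeds_comp {S T U i j} : embeds S T i -> embeds T U j ->
  embeds S U (j \o i).
Proof.
move=> [Si im] [Tj jm]; split=> [s Ss|s t Ss St st] /=; first exact/Tj/Si.
by apply: jm; [exact: Si|exact: Si|exact: im].
Qed.

Lemma embeds_prefix {S T j s t} : embeds S T j -> S s -> S t -> prefix s t ->
  prefix (j s) (j t).
Proof.
move=> [_ jm] Ss St st; have [->|st'] := eqVneq s t; first exact: prefix_refl.
have : proper_prefix s t by rewrite /proper_prefix st st'.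
by move=> /(jm _ _ Ss St)/andP[].
Qed.

Lemma embeds_shift S z : embeds S (shift z @` S) (shift z).
Proof.
by split=> [s Ss|s t _ _]; [exists s|rewrite proper_prefix_shift].
Qed.

Lemma embeds_unshift S z : exists j, embeds (shift z @` S) S j.
Proof.
pose j s := xget [::] [set t | shift z t = s].
have jK : cancel (shift z) j.
  by move=> t; apply: xget_unique => // u /= /shift_inj.
exists j => //; split=> [_ [t St <-]|_ _ [s Ss <-] [t St <-]].
  by rewrite jK.
by rewrite !jK proper_prefix_shift.
Qed.

(** At a successor, Gamma_d is the part n = 1 of Gamma_{d+1}. At a limit, the piece at [zeta] of the
    union is a shifted copy of Gamma_{zeta+1}, which contains Gamma_zeta. *)
Lemma Gamma_embeds zeta xi : (zeta <= xi)%O ->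
  exists j, embeds (Gamma zeta) (Gamma xi) j.
Proof.
have succ z : embeds (Gamma z) (Gamma (osucc z)) id.
  by apply: embeds_id => t Gt; rewrite GammaS; exists 1%N.
elim/(well_founded_ind ord_lt_wf): xi => xi IH.
rewrite le_eqVlt => /orP[/eqP <-|zx]; first by exists id; exact: embeds_id.
case: (ord_cases xi) => [x0|[d xd]|xl].
- by move: zx; rewrite x0 ltNge ozero_le.
- move: zx; rewrite xd lt_osucc => zd.
  have [|j jm] := IH d _ zd; first by rewrite xd osucc_gt.
  by exists (id \o j); exact: embeds_comp jm (succ d).
- exists (shift (omegaX zeta) \o id); apply: (embeds_comp (succ zeta)).
  split=> [s Gs|s t _ _]; last by rewrite proper_prefix_shift.
  by rewrite (GammaL xl); exists zeta => //; exists s.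
Qed.

(* [P] constrains the images of all nodes, [Q] only the images of leaves under
   the extension [e]. *)
Definition treehom (S T : set (seq Ord)) (P : seq Ord -> seq Ord -> Prop)
    (Q : seq Ord -> Prop) : Prop :=
  exists theta e, [/\ embeds S T theta,
    forall t, MAX S t -> [/\ MAX T (e t), prefix (theta t) (e t) & Q (e t)] &
    forall s, S s -> P s (theta s)].

Lemma treehom_sub {S T P P' Q Q'} : treehom S T P Q ->
  (forall s t, S s -> T t -> P s t -> P' s t) ->
  (forall t, MAX T t -> Q t -> Q' t) -> treehom S T P' Q'.
Proof.
move=> [theta [e [th ext Pth]]] PP' QQ'; exists theta, e; split=> //.
  by move=> t /ext[Me te /(QQ' _ Me)].
by move=> s Ss; apply: PP' (Pth _ Ss) => //; exact: th.1.
Qed.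

(** The image of a leaf under [j] need not be a leaf, so [l] first continues it to a leaf of [T], to
    which [e] applies. *)
Lemma treehom_precomp {w S T U P P' Q j} : is_tree w T -> embeds S T j ->
  treehom T U P Q -> (forall s u, S s -> P (j s) u -> P' s u) ->
  treehom S U P' Q.
Proof.
move=> tT jST [theta [e [th ext Pth]]] PP'.
have leaf s : exists l, S s -> MAX T l /\ prefix (j s) l.
  have [Ss|] := pselect (S s); last by exists [::].
  by have [l Ml jl] := tree_leaf _ _ tT (jST.1 _ Ss); exists l.
have {leaf}[l lP] := choice leaf.
exists (theta \o j), (e \o l); split.
- exact: embeds_comp th.
- move=> t [St _]; have [Ml jl] := lP _ St; have [Me te Qe] := ext _ Ml.
  split=> //=; apply: prefix_trans te.
  by apply: (embeds_prefix th) => //; [exact: jST.1|case: Ml].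
- by move=> s Ss; apply: PP' => //; apply: Pth; exact: jST.1.
Qed.

Lemma treehom_shift {S T z P P' Q Q'} : treehom S T P Q ->
  (forall s t, S s -> T t -> P s t -> P' s (shift z t)) ->
  (forall t, MAX T t -> Q t -> Q' (shift z t)) ->
  treehom S (shift z @` T) P' Q'.
Proof.
move=> [theta [e [th ext Pth]]] PP' QQ'.
exists (shift z \o theta), (shift z \o e); split.
- exact: embeds_comp th (embeds_shift _ _).
- move=> t /ext[Me te Qe]; split=> /=; last exact: QQ'.
    by rewrite MAX_shift; exists (e t).
  by rewrite prefix_shift.
- by move=> s Ss; apply: PP' => //; [exact: th.1|exact: Pth].
Qed.

(** Comparable nodes lie in the same piece, so maps chosen independently on the pieces glue
    together, even if several pieces have the same target. *)
Lemma treehom_bigcup {T : choiceType} {I : set T} {S : T -> set (seq Ord)}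
    {P Q} :
  (forall i j s t, I i -> I j -> S i s -> S j t -> prefix s t -> i = j) ->
  I !=set0 ->
  (forall i, I i -> exists2 j, I j & treehom (S i) (S j) P Q) ->
  treehom (\bigcup_(i in I) S i) (\bigcup_(i in I) S i) P Q.
Proof.
move=> disj [i0 Ii0] H.
have {}H i : exists p : T * (seq Ord -> seq Ord) * (seq Ord -> seq Ord),
    I i -> I p.1.1 /\ [/\ embeds (S i) (S p.1.1) p.1.2,
      forall t, MAX (S i) t ->
        [/\ MAX (S p.1.1) (p.2 t), prefix (p.1.2 t) (p.2 t) & Q (p.2 t)] &
      forall s, S i s -> P s (p.1.2 s)].
  have [/H[j Ij [theta [e te]]]|] := pselect (I i); last by exists (i0, id, id).
  by exists (j, theta, e).
have {H}[p pP] := choice H.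
pose idx s := xget i0 [set i | I i /\ S i s].
have idxE i s : I i -> S i s -> idx s = i.
  move=> Ii Ss; apply: xget_unique => // j [Ij Sj].
  by apply: (disj _ _ _ _ Ij Ii Sj Ss); exact: prefix_refl.
exists (fun s => (p (idx s)).1.2 s), (fun s => (p (idx s)).2 s).
split.
- split=> [s [i Ii Ss]|s t [i Ii Ss] [j Ij Sjt] st].
    by have [Ij [th _ _]] := pP i Ii; rewrite (idxE i)//;
      exists (p i).1.1 => //; exact: th.1.
  have ij : i = j by apply: (disj _ _ _ _ Ii Ij Ss Sjt); case/andP: st.
  subst j; rewrite !(idxE i)//; have [_ [th _ _]] := pP i Ii.
  exact: th.2.
- rewrite (MAX_bigcup disj) => t [i Ii Mt]; have [Ij [_ ext _]] := pP i Ii.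
  rewrite !(idxE i)//; last by case: Mt.
  have [Me te Qe] := ext _ Mt; split=> //.
  by exists (p i).1.1.
- move=> s [i Ii Ss]; have [_ [_ _ H]] := pP i Ii.
  by rewrite (idxE i)//; exact: H.
Qed.

(** * Grafting of maps and selection of levels *)

Lemma proper_prefix_cat (s t u : seq Ord) : prefix s t -> u != [::] ->
  proper_prefix s (t ++ u).
Proof.
move=> st u0; rewrite /proper_prefix prefix_catl//=.
apply: contraNneq u0 => stu; have := size_prefix st.
rewrite stu size_cat -[X in (_ <= X)%N]addn0 leq_add2l leqn0.
by rewrite size_eq0.
Qed.

Lemma proper_prefix_cat2l (s t u : seq Ord) :
  proper_prefix (s ++ t) (s ++ u) = proper_prefix t u.
Proof. by rewrite /proper_prefix prefix_cat2l eqseq_cat// eqxx. Qed.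

(** Nodes of the bottom tree move by [theta0], whereas the copy above a leaf t is carried by [eta t]
    into the copy above [e0 t], because [theta0 t] need not be a leaf. A nonempty [tl] marks the
    nodes of the copies. *)
Definition graft xi m n (theta0 e0 : seq Ord -> seq Ord)
    (eta : seq Ord -> seq Ord -> seq Ord) (x : seq Ord) : seq Ord :=
  if tl xi m x == [::] then shift (wn xi n) (theta0 (hd xi m x))
  else shift (wn xi n) (e0 (hd xi m x)) ++ eta (hd xi m x) (tl xi m x).

Section Graft.
Variables (xi : Ord) (m n : nat) (theta0 e0 : seq Ord -> seq Ord).
Variable eta : seq Ord -> seq Ord -> seq Ord.

Lemma graft_shift t :
  graft xi m n theta0 e0 eta (shift (wn xi m) t) = shift (wn xi n) (theta0 t).
Proof.
by rewrite /graft tl_shift eqxx hd_shift//; exact: Gamma_tree.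
Qed.

Lemma graft_cat t u : Gamma_n xi m u ->
  graft xi m n theta0 e0 eta (shift (wn xi m) t ++ u) =
  shift (wn xi n) (e0 t) ++ eta t u.
Proof.
have T := Gamma_tree xi; move=> Gu.
rewrite /graft tl_cat// hd_cat//; last by right.
by rewrite (negbTE (Gamma_n_neq0 _ T _ _ Gu)).
Qed.

Lemma graft_embeds : embeds (Gamma xi) (Gamma xi) theta0 ->
  (forall t, MAX (Gamma xi) t ->
    MAX (Gamma xi) (e0 t) /\ prefix (theta0 t) (e0 t)) ->
  (forall t, MAX (Gamma xi) t ->
    embeds (Gamma_n xi m) (Gamma_n xi n) (eta t)) ->
  embeds (Gamma_n xi m.+1) (Gamma_n xi n.+1) (graft xi m n theta0 e0 eta).
Proof.
have T := Gamma_tree xi; move=> th0 ext0 eta_emb; split.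
  move=> x /Gamma_nP[t Gt|t u Mt Gu].
    by rewrite graft_shift; apply: Gamma_n_shift; exact: th0.1.
  rewrite graft_cat//; apply: Gamma_n_cat; first by have [] := ext0 _ Mt.
  exact: (eta_emb _ Mt).1.
move=> x y Gx Gy /andP[xy].
case: (Gamma_n_prefixP _ T _ _ _ Gx Gy xy) =>
  [s t Gs Gt st|s t u Gs Mt Gu st|t u v Mt Gu Gv uv] ne.
- rewrite !graft_shift proper_prefix_shift; apply: th0.2 => //.
  by rewrite /proper_prefix st; apply: contraNneq ne => ->.
- rewrite graft_shift graft_cat//; apply: proper_prefix_cat.
    rewrite prefix_shift; have [_] := ext0 _ Mt; apply: prefix_trans.
    by apply: (embeds_prefix th0) => //; case: Mt.
  exact: (Gamma_n_neq0 _ T n _ ((eta_emb _ Mt).1 _ Gu)).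
- rewrite !graft_cat// proper_prefix_cat2l; apply: (eta_emb _ Mt).2 => //.
  by rewrite /proper_prefix uv; apply: contraNneq ne => ->.
Qed.

End Graft.

(** Good levels are used greedily from the bottom: a good level hosts the next level of
    Gamma_{xi,m}, and a bad one is passed through along a single fixed leaf, so that no image lies
    on it. *)
Lemma level_embeds xi (good : nat -> bool) m n :
  (m <= \sum_(i < n) good i)%N ->
  exists2 j, embeds (Gamma_n xi m) (Gamma_n xi n) j &
    forall x, Gamma_n xi m x -> good (level xi n (j x)).
Proof.
have triv (good' : nat -> bool) k :
    exists2 j, embeds (Gamma_n xi 0) (Gamma_n xi k) j &
    forall x, Gamma_n xi 0 x -> good' (level xi k (j x)).
  by exists id => [|x []]; split=> [x []|x y []].
elim: n good m => [|n IH] good [|m] //; first by rewrite big_ord0.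
rewrite big_ord_recl /=; case g0 : (good 0%N) => /= mS.
  have [|j jm jg] := IH (good \o S) m; first by move: mS; rewrite add1n ltnS.
  exists (graft xi m n id id (fun _ => j)).
    apply: graft_embeds => //; first exact: embeds_id.
    by move=> t Mt; split=> //; exact: prefix_refl.
  move=> x /Gamma_nP[t Gt|t u Mt Gu]; first by rewrite graft_shift level_shift.
  rewrite graft_cat// level_cat//; first exact: jg.
  exact: jm.1.
have [|j jm jg] := IH (good \o S) m.+1; first by move: mS; rewrite add0n.
have [t0 Mt0] := MAX_Gamma_neq0 _ (Gamma_tree xi) (Gamma_neq0 xi).
exists (fun x => shift (wn xi n) t0 ++ j x).
  split=> [x Gx|x y Gx Gy xy]; last by rewrite proper_prefix_cat2l; exact: jm.2.
  by apply: Gamma_n_cat => //; exact: jm.1.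
move=> x Gx; rewrite level_cat//; first exact: jg.
exact: jm.1.
Qed.

(** * Pigeonhole, rounding and branch sums *)

(** Otherwise every colour v has a bound [F v] in [I] from which on it does not occur; an element
    above these finitely many bounds has no colour left. *)
Lemma cofinal_color d (T : orderType d) (I : set T) (C : finType) (c : T -> C) :
  I !=set0 ->
  exists v, forall i, I i -> exists j, [/\ I j, (i <= j)%O & c j = v].
Proof.
move=> [i0 Ii0]; apply: contrapT => noC.
have H v : exists i, I i /\ forall j, I j -> (i <= j)%O -> c j <> v.
  apply: contrapT => nH; apply: noC; exists v => i Ii; apply: contrapT => nj.
  by apply: nH; exists i; split=> // j Ij ij cj; apply: nj; exists j.
have [F FP] := choice H.
have [m [Im Fm]] : exists m, I m /\ forall v, v \in enum C -> (F v <= m)%O.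
  elim: (enum C) => [|v s [m [Im Fm]]]; first by exists i0.
  exists (Order.max (F v) m); split.
    by case: leP => _ //; have [] := FP v.
  move=> u; rewrite inE => /predU1P[->|/Fm us]; first by rewrite le_max lexx.
  by rewrite le_max us orbT.
by have [_ /(_ m Im)] := FP (c m); apply => //; apply: Fm; rewrite mem_enum.
Qed.

Section Real.
Variable R : realType.
Implicit Types (f F G : seq Ord -> R).

(** The grid consists of the points -M + k eps with k <= 2M/eps, and x is rounded down. Finiteness
    of [D] lets rounded values serve as colours. *)
Lemma rounding (M eps : R) : 0 <= M -> 0 < eps ->
  exists (D : finType) (r : R -> D) (g : D -> R), (forall d, `|g d| <= M) /\
    forall x, `|x| <= M -> g (r x) <= x < g (r x) + eps.
Proof.
move=> M0 e0; pose K := Num.truncn (M *+ 2 / eps).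
exists 'I_K.+1, (fun x => inord (Num.truncn ((x + M) / eps))),
  (fun k : 'I_K.+1 => k%:R * eps - M).
have Kle : K%:R * eps <= M *+ 2.
  by rewrite -ler_pdivlMr// truncn_le divr_ge0 ?(ltW e0)// mulrn_wge0.
split=> [k|x].
  have : k%:R * eps <= M *+ 2.
    by apply: le_trans Kle; rewrite ler_pM2r// ler_nat -ltnS.
  have : 0 <= k%:R * eps by rewrite mulr_ge0// ltW.
  by rewrite ler_norml mulr2n => *; apply/andP; split; lra.
rewrite ler_norml => /andP[Mx xM].
have xM0 : 0 <= (x + M) / eps by rewrite divr_ge0 ?(ltW e0)//; lra.
rewrite inordK; last first.
  rewrite ltnS; apply: le_truncn; rewrite ler_pM2r ?invr_gt0// mulr2n; lra.
have /andP[] := truncn_itv xM0; rewrite ler_pdivlMr// ltr_pdivrMr//.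
set k := Num.truncn _; rewrite -natr1 mulrDl mul1r => *.
by apply/andP; split; lra.
Qed.

(** A Markov-type count: if k terms are at least A - eps, the sum is at most n(A - eps) + k(M - A +
    eps), where M - A + eps <= 2M + eps. Fewer than m such terms would therefore give n eps <= m(2M
    + eps). *)
Lemma many_large (a : nat -> R) (M A eps : R) (m n : nat) :
  0 < eps -> (forall i, (i < n)%N -> `|a i| <= M) -> `|A| <= M ->
  n%:R * A <= \sum_(i < n) a i -> m%:R * (M *+ 2 + eps) < n%:R * eps ->
  (m <= \sum_(i < n) (A - eps <= a i)%R)%N.
Proof.
move=> e0 aM AM Asum mn; rewrite leqNgt; apply/negP => km.
set k := (\sum_(i < n) _)%N in km.
have : \sum_(i < n) a i <= n%:R * (A - eps) + k%:R * (M - A + eps).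
  rewrite mulr_natl -[n in _ *+ n]card_ord -sumr_const /k natr_sum mulr_suml.
  rewrite -big_split /=; apply: ler_sum => i _.
  have := aM i (ltn_ord i); rewrite ler_norml => /andP[_ aiM].
  case: (leP (A - eps) (a i)) => [_|/ltW]; first by rewrite mul1r; lra.
  by rewrite mul0r addr0.
have kM : k%:R * (M - A + eps) <= m%:R * (M *+ 2 + eps).
  move: AM; rewrite ler_norml => /andP[AM1 AM2].
  by apply: ler_pM => //; [lra|rewrite ler_nat ltnW|rewrite mulr2n; lra].
by rewrite mulrBr => ?; lra.
Qed.

Definition brsum F (t : seq Ord) : R := \sum_(0 <= k < size t) F (take k.+1 t).

Lemma brsum_shift F z t : brsum F (shift z t) = brsum (F \o shift z) t.
Proof.
by rewrite /brsum size_map; apply: eq_bigr => k _; rewrite /= /shift map_take.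
Qed.

Lemma brsum_cat F t u :
  brsum F (t ++ u) = brsum F t + brsum (fun v => F (t ++ v)) u.
Proof.
rewrite /brsum size_cat (big_cat_nat _ (leq_addr _ _))//=; congr (_ + _).
  by apply: eq_big_nat => k /andP[_ kt]; rewrite takel_cat.
rewrite -{1}[size t]add0n big_addn addKn; apply: eq_big_nat => k _.
by rewrite take_cat -addSn ltnNge leq_addl /= addnK.
Qed.

Lemma brsumZ a F t : brsum (fun s => a * F s) t = a * brsum F t.
Proof. by rewrite /brsum mulr_sumr. Qed.

Lemma eq_brsum w S F G t : is_tree w S -> S t -> (forall s, S s -> F s = G s) ->
  brsum F t = brsum G t.
Proof.
move=> T St FG; apply: eq_big_nat => k /andP[_ kt]; apply: FG.
apply: (tree_prefix _ _ T St); first exact: prefix_take.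
by rewrite -size_eq0 size_takel.
Qed.

(** Closure under nonempty prefixes identifies the index set with the list of all [take k.+1 t],
    whose members differ in length. *)
Lemma fsbig_brsum w S F t : is_tree w S -> S t ->
  \sum_(s \in [set s | S s /\ prefix s t]) F s = brsum F t.
Proof.
move=> T St; rewrite /brsum.
have -> : [set s | S s /\ prefix s t] =
    [set` [seq take k.+1 t | k <- index_iota 0 (size t)]].
  apply/seteqP; split=> [s [Ss st]|_ /mapP[k + ->]] /=.
    have s0 := tree_neq0 _ _ T _ Ss.
    apply/mapP; exists (size s).-1.
      rewrite mem_index_iota /= prednK ?lt0n ?size_eq0//; exact: size_prefix.
    by rewrite prednK ?lt0n ?size_eq0//; move: st; rewrite prefixE => /eqP.
  rewrite mem_index_iota => /andP[_ kt]; split; last exact: prefix_take.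
  apply: (tree_prefix _ _ T St); first exact: prefix_take.
  by rewrite -size_eq0 size_takel.
rewrite -fsbig_seq ?big_map// map_inj_in_uniq ?iota_uniq// => i j.
rewrite !mem_index_iota => /andP[_ it] /andP[_ jt] /(congr1 size).
by rewrite !size_takel// => -[].
Qed.

(** * The induction *)

(** All finite colour types are allowed because the passage from n to n + 1 adds rounded numbers to
    the colour; the bound on [a] keeps it in the range of [rounding]. *)
Definition stabilizes xi : Prop :=
  forall f (M delta : R) (C : finType) (c : seq Ord -> C),
  0 < delta -> (forall s, Gamma xi s -> `|f s| <= M) ->
  exists a v, `|a| <= M /\ treehom (Gamma xi) (Gamma xi) (fun _ s => a <= f s)
    (fun t => c t = v /\ brsum (fun s => prob R xi s * f s) t <= delta + a).

Definition stabilizes_n xi n : Prop :=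
  forall f (M delta : R) (C : finType) (c : seq Ord -> C),
  0 < delta -> (forall s, Gamma_n xi n s -> `|f s| <= M) ->
  exists (a : nat -> R) v, (forall i, (i < n)%N -> `|a i| <= M) /\
    treehom (Gamma_n xi n) (Gamma_n xi n) (fun s s' => a (level xi n s) <= f s')
    (fun t => c t = v /\
       brsum (fun s => prob_n R xi n s * f s) t <= delta + \sum_(i < n) a i).

(* As f >= -M, replacing a by max(a, -M) preserves both conclusions. *)
Lemma stabilizes_clip xi :
  (forall f (M delta : R) (C : finType) (c : seq Ord -> C),
    0 < delta -> (forall s, Gamma xi s -> `|f s| <= M) ->
    exists a v, treehom (Gamma xi) (Gamma xi) (fun _ s => a <= f s)
      (fun t => c t = v /\
         brsum (fun s => prob R xi s * f s) t <= delta + a)) ->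
  stabilizes xi.
Proof.
move=> H f M delta C c d0 fM; have [a [v h]] := H f M delta C c d0 fM.
exists (Num.max a (- M)), v; split; last first.
  apply: (treehom_sub h) => [s t _ /fM|t _ [-> H']].
    by rewrite ler_norml ge_max => /andP[-> _ ->].
  by split=> //; rewrite (le_trans H')// lerD2l le_max lexx.
have [theta [_ [th _ Pth]]] := h; have [s Gs] := Gamma_neq0 xi.
have := fM _ (th.1 _ Gs); have := Pth _ Gs.
rewrite !ler_norml le_max lexx orbT /=.
by rewrite ge_max => ? /andP[? ?]; apply/andP; split; lra.
Qed.

Lemma stabilizes0 : stabilizes ozero.
Proof.
apply: stabilizes_clip => f M delta C c d0 fM.
exists (f [:: ozero]), (c [:: ozero]).
exists id, id; rewrite Gamma0; split; first exact: embeds_id.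
  move=> _ [-> _]; split; [by split=> // u ->|by rewrite prefix_refl|].
  split=> //; rewrite /brsum big_nat1 /= prob0 mul1r; lra.
by move=> _ ->.
Qed.

Lemma stabilizes_n1 xi : stabilizes xi -> stabilizes_n xi 1.
Proof.
move=> H f M delta C c d0 fM; have [a [v [aM h]]] := H f M delta C c d0 fM.
exists (fun=> a), v; split=> //; apply: (treehom_sub h) => // t [Gt _] [-> le].
split=> //; rewrite big_ord1; apply: le_trans le.
rewrite le_eqVlt; apply/orP; left; apply/eqP.
apply: (eq_brsum _ _ _ _ _ (Gamma_tree xi) Gt) => s Gs.
by have := prob_n_shift R Gs (n := 0); rewrite wn0 shift0 => ->.
Qed.

Lemma stabilizes_nS xi n : (0 < n)%N -> stabilizes xi -> stabilizes_n xi n ->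
  stabilizes_n xi n.+1.
Proof.
move=> n0 H Hn f M delta C c d0 fM.
have T := Gamma_tree xi; have Tn := Gamma_n_tree xi T (Gamma_neq0 xi) n.
have M0 : 0 <= M.
  have [s /fM] := Gamma_n_nonempty xi (Gamma_neq0 xi) n.+1 isT.
  exact/le_trans/normr_ge0.
(* There are n + 2 errors: one from the bottom tree, one from the upper copy, and one for rounding
   each of the n numbers of that copy. *)
pose eps := delta / (n.+2)%:R.
have e0 : 0 < eps by rewrite divr_gt0.
pose ft t u := f (shift (wn xi n) t ++ u).
pose ct t u := c (shift (wn xi n) t ++ u).
have sel t : exists p : (nat -> R) * C, MAX (Gamma xi) t ->
    (forall i, (i < n)%N -> `|p.1 i| <= M) /\
    treehom (Gamma_n xi n) (Gamma_n xi n) 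
      (fun s s' => p.1 (level xi n s) <= ft t s')
    (fun u => ct t u = p.2 /\
       brsum (fun s => prob_n R xi n s * ft t s) u <= eps + \sum_(i < n) p.1 i).
  have [Mt|nMt] := pselect (MAX (Gamma xi) t); last first.
    by exists (fun=> 0, c [::]) => /nMt.
  have [|a [v P]] := Hn (ft t) M eps C (ct t) e0; last by exists (a, v).
  by move=> u Gu; apply: fM; exact: Gamma_n_cat.
have {sel}[p pP] := choice sel.
have [D [r [g [gM rg]]]] := rounding M eps M0 e0.
(* The colour of a leaf records the rounded numbers and the constant colour obtained on the copy
   above it. *)
pose c0 t : {ffun 'I_n -> D} * C := ([ffun i : 'I_n => r ((p t).1 i)], (p t).2).
have [|a0 [[d v] [a0M [theta0 [e0' [th0 ext0 P0]]]]]] :=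
  H (f \o shift (wn xi n)) M eps _ c0 e0.
  by move=> s Gs; apply: fM; exact: Gamma_n_shift.
(* All image leaves [e0' t] have colour [(d, v)], so the numbers of the copies above them agree up
   to [eps]. *)
have dP t (i : 'I_n) : MAX (Gamma xi) t ->
    g (d i) <= (p (e0' t)).1 i < g (d i) + eps.
  move=> /ext0[Me _ [[<- _] _]]; rewrite ffunE; apply: rg.
  exact: (pP _ Me).1.
(* Level 0 gets the number of the bottom tree and level j + 1 the grid value at j; the 0 for j >= n
   is a junk value. *)
pose a i := if i is j.+1 then oapp (fun j => g (d j)) 0 (insub j) else a0.
have aS (i : 'I_n) : a i.+1 = g (d i) by rewrite /= valK.
(* Above t, the maps chosen for the copy above [e0' t] are taken. Rounding down preserves the lower
   bound on f and costs [eps] per level in the sum. *)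
have sela t : exists q : (seq Ord -> seq Ord) * (seq Ord -> seq Ord),
    MAX (Gamma xi) t ->
    [/\ embeds (Gamma_n xi n) (Gamma_n xi n) q.1,
      forall u, MAX (Gamma_n xi n) u -> [/\ MAX (Gamma_n xi n) (q.2 u),
        prefix (q.1 u) (q.2 u), ct (e0' t) (q.2 u) = v &
        brsum (fun s => prob_n R xi n s * ft (e0' t) s) (q.2 u)
          <= eps + \sum_(i < n) (g (d i) + eps)] &
      forall u, Gamma_n xi n u ->
        a (level xi n u).+1 <= ft (e0' t) (q.1 u)].
  have [Mt|nMt] := pselect (MAX (Gamma xi) t); last by exists (id, id) => /nMt.
  have [Me _ [[_ pv] _]] := ext0 _ Mt.
  have [_ [theta [e [th ext P]]]] := pP _ Me.
  exists (theta, e) => _; split=> //=.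
    move=> u /ext[Meu te [cv le]]; split=> //; first by rewrite cv.
    apply: (le_trans le); rewrite lerD2l; apply: ler_sum => i _.
    by have /andP[_ /ltW] := dP t i Mt.
  move=> u Gu; have Pu := P _ Gu; have l := level_lt Gu.
  have := aS (Ordinal l) => /= ->; apply: le_trans Pu.
  by have /andP[] := dP t (Ordinal l) Mt.
have {sela}[q qP] := choice sela.
exists a, v; split.
  case=> [_|i]; first exact: a0M.
  by rewrite ltnS => l; rewrite (aS (Ordinal l)).
(* Leaves of Gamma_{xi,n+1} have a nonempty upper part, so on them the second graft is given by
   [e0'] and the extensions [(q t).2]. *)
exists (graft xi n n theta0 e0' (fun t => (q t).1)),
  (graft xi n n theta0 e0' (fun t => (q t).2)); split.
- apply: graft_embeds => // t Mt; first by have [] := ext0 _ Mt.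
  by have [] := qP _ Mt.
- rewrite (MAX_Gamma_nS _ T); last exact: Gamma_n_nonempty (Gamma_neq0 xi) _ n0.
  move=> _ [t Mt [u Mu <-]]; have Gu := Mu.1.
  have [Me te [_ le0]] := ext0 _ Mt.
  have [th ext _] := qP _ Mt; have [Meu teu cv le] := ext _ Mu.
  rewrite !graft_cat//=; split; [|by rewrite prefix_cat2l|split=> //].
    by exists (e0' t) => //; exists ((q t).2 u).
  rewrite brsum_cat brsum_shift.
  rewrite (eq_brsum _ _ _
    (fun s => prob R xi s * (f \o shift (wn xi n)) s) _ T Me.1);
    last by move=> s Gs; rewrite /= prob_n_shift.
  rewrite (eq_brsum _ _ _ (fun s => prob_n R xi n s * ft (e0' t) s) _ Tn Meu.1);
    last by move=> s Gs; rewrite prob_n_cat.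
  apply: (le_trans (lerD le0 le)).
  rewrite big_ord_recl /= big_split sumr_const card_ord /=.
  under [X in _ <= _ + (_ + X)]eq_bigr do rewrite -/(a _.+1) aS.
  have -> : delta = eps *+ n.+2 by rewrite -mulr_natr /eps divfK// pnatr_eq0.
  by rewrite !mulrS; lra.
- move=> _ /Gamma_nP[t Gt|t u Mt Gu].
    by rewrite level_shift// graft_shift; exact: P0.
  rewrite level_cat// graft_cat//; have [_ _ P] := qP _ Mt.
  exact: P.
Qed.

Lemma stabilizes_succ zeta : (forall n, (0 < n)%N -> stabilizes_n zeta n) ->
  stabilizes (osucc zeta).
Proof.
move=> Hn; apply: stabilizes_clip => f M delta C c d0 fM.
have T := Gamma_tree zeta; have N0 := Gamma_neq0 zeta.
have sub n s : (0 < n)%N -> Gamma_n zeta n s -> Gamma (osucc zeta) s.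
  by move=> n0 Gs; rewrite GammaS; exists n.
have M0 : 0 <= M.
  by have [s /fM] := Gamma_neq0 (osucc zeta); exact/le_trans/normr_ge0.
(* One third each for the error of the branch sum, for rounding the average, and for lowering the
   threshold from [g d] to [g d - eps]. *)
pose eps := delta / 3.
have e0 : 0 < eps by rewrite divr_gt0.
have sel n : exists p : (nat -> R) * C, (0 < n)%N ->
    (forall i, (i < n)%N -> `|p.1 i| <= M) /\
    treehom (Gamma_n zeta n) (Gamma_n zeta n)
      (fun s s' => p.1 (level zeta n s) <= f s')
      (fun u => c u = p.2 /\
         brsum (fun s => prob_n R zeta n s * f s) u
           <= eps + \sum_(i < n) p.1 i).
  case: n => [|n]; first by exists (fun=> 0, c [::]).
  have [|a [v P]] := Hn n.+1 isT f M eps C c e0; last by exists (a, v).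
  by move=> s Gs; apply/fM/(sub n.+1).
have {sel}[p pP] := choice sel.
have [D [r [g [gM rg]]]] := rounding M eps M0 e0.
pose avg n := n%:R^-1 * \sum_(i < n) (p n).1 i.
have avgM n : (0 < n)%N -> `|avg n| <= M.
  move=> n0; rewrite /avg normrM normfV normr_nat mulrC ler_pdivrMr ?ltr0n//.
  apply: (le_trans (ler_norm_sum _ _ _)).
  rewrite mulr_natr -[n in M *+ n]card_ord.
  by rewrite -sumr_const; apply: ler_sum => i _; exact: (pP _ n0).1.
have [|[d v] dv] := cofinal_color _ nat [set n | (0 < n)%N] _
  (fun n => (r (avg n), (p n).2)); first by exists 1%N.
exists (g d - eps), v; rewrite GammaS; apply: treehom_bigcup.
- by move=> i j s t _ _; exact: Gamma_n_disj.
- by exists 1%N.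
(* [N] makes m(2M + eps) < n eps for all n >= [N], as [many_large] requires; it is at least 1
   because the index 0 is excluded. *)
move=> m m0; pose N := maxn 1 (Num.truncn (m%:R * (M *+ 2 + eps) / eps)).+1.
have [n [n0 Nn [dE vE]]] := dv N (leq_maxl _ _).
have [aM h] := pP n n0.
have /andP[] := rg _ (avgM n n0); rewrite dE => gavg avgg.
have nn0 : 0 < n%:R :> R by rewrite ltr0n.
(* As the average is at least [g d], at least m levels of Gamma_{zeta,n} have numbers at least
   [g d - eps]; Gamma_{zeta,m} is sent through these. *)
have [|j jm jg] := level_embeds zeta (fun i => g d - eps <= (p n).1 i) m n.
  apply: (many_large _ M) => //.
    by move: gavg; rewrite /avg mulrC ler_pdivlMr// mulrC.
  rewrite -ltr_pdivrMr//; apply: lt_le_trans (truncnS_gt _) _.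
  rewrite ler_nat; apply: leq_trans Nn; exact: leq_maxr.
exists n => //.
have {}h := treehom_precomp (Gamma_n_tree zeta T N0 n) jm h
  (P' := fun _ u => g d - eps <= f u) _.
apply: (treehom_sub (h _)) => // [s u Ss|t [Gt _] [cv le]].
  by apply: le_trans; exact: jg.
rewrite cv vE; split=> //.
(* The factor 1/n turns the sum of the numbers into their average [avg n]. *)
rewrite (eq_brsum _ _ _ (fun s => n%:R^-1 * (prob_n R zeta n s * f s)) _
  (Gamma_n_tree zeta T N0 n) Gt); last first.
  by move=> s Gs; rewrite (prob_succ R n0 Gs) mulrA.
rewrite brsumZ (@le_trans _ _ (n%:R^-1 * (eps + \sum_(i < n) (p n).1 i)))//.
  by rewrite ler_pM2l// invr_gt0.
rewrite mulrDr -/(avg n).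
have : n%:R^-1 * eps <= eps by rewrite ler_piMl ?(ltW e0)// invf_le1// ler1n.
by rewrite /eps in avgg *; lra.
Qed.

Lemma stabilizes_limit xi : is_limit xi ->
  (forall zeta, (zeta < xi)%O -> stabilizes zeta) -> stabilizes xi.
Proof.
move=> xl H; apply: stabilizes_clip => f M delta C c d0 fM.
have sub zeta t : (zeta < xi)%O -> Gamma (osucc zeta) t ->
    Gamma xi (shift (omegaX zeta) t).
  by move=> zx Gt; rewrite (GammaL xl); exists zeta => //; exists t.
have M0 : 0 <= M.
  by have [s /fM] := Gamma_neq0 xi; exact/le_trans/normr_ge0.
(* One half for the error of the branch sum, one half for rounding. *)
pose eps := delta / 2.
have e0 : 0 < eps by rewrite divr_gt0.
have sel zeta : exists p : R * C, (zeta < xi)%O -> `|p.1| <= M /\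
    treehom (Gamma (osucc zeta)) (Gamma (osucc zeta))
      (fun _ s => p.1 <= f (shift (omegaX zeta) s))
      (fun t => c (shift (omegaX zeta) t) = p.2 /\
         brsum (fun s => prob R (osucc zeta) s * f (shift (omegaX zeta) s)) t
         <= eps + p.1).
  have [zx|] := boolP (zeta < xi)%O; last by exists (0, c [::]).
  have [|a [v P]] := H _ (limit_osucc xl zx) (f \o shift (omegaX zeta)) M eps C
    (c \o shift (omegaX zeta)) e0; last by exists (a, v).
  by move=> s Gs; apply/fM/sub.
have {sel}[p pP] := choice sel.
have [D [r [g [gM rg]]]] := rounding M eps M0 e0.
have x0 := limit_gt0 xl.
have [|[d v] dv] := cofinal_color _ Ord [set z | (z < xi)%O] _
  (fun z => (r (p z).1, (p z).2)); first by exists ozero.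
exists (g d), v; rewrite (GammaL xl); apply: treehom_bigcup.
- by move=> i j s t _ _; apply: limit_disj; exact: Gamma_tree.
- by exists ozero.
move=> zeta zx; have [eta [ex ze [dE vE]]] := dv zeta zx.
exists eta => //; have [aM h] := pP eta ex.
have /andP[] := rg _ aM; rewrite dE => ga ag.
have [j jm] : exists j, embeds (Gamma (osucc zeta)) (Gamma (osucc eta)) j.
  by apply: Gamma_embeds; rewrite osucc_le lt_osucc.
(* The piece at [zeta] is unshifted, embedded into Gamma_{eta+1}, mapped there by the homomorphism
   chosen for [eta], and shifted into the piece at [eta]. *)
have [i im] := embeds_unshift (Gamma (osucc zeta)) (omegaX zeta).
have {}h := treehom_precomp (Gamma_tree (osucc eta)) (embeds_comp im jm) h
  (P' := fun _ u => g d <= f (shift (omegaX eta) u)) _.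
apply: (treehom_shift (h _)) => // [s u _|t [Gt _] [cv le]].
  exact: le_trans.
rewrite cv vE; split=> //; rewrite brsum_shift.
rewrite (eq_brsum _ _ _
  (fun s => prob R (osucc eta) s * f (shift (omegaX eta) s)) _
  (Gamma_tree (osucc eta)) Gt); last first.
  by move=> s Gs; rewrite /= (prob_limit R xl ex Gs).
apply: (le_trans le); rewrite /eps in ag *; lra.
Qed.

Lemma stabilizes_n_of_stabilizes xi n : (0 < n)%N -> stabilizes xi ->
  stabilizes_n xi n.
Proof.
case: n => // n _ H; elim: n => [|n IH]; first exact: stabilizes_n1.
exact: stabilizes_nS.
Qed.

Lemma stabilizes_all xi : stabilizes xi.
Proof.
elim/(well_founded_ind ord_lt_wf): xi => xi IH.
case: (ord_cases xi) => [->|[zeta xz]|xl].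
- exact: stabilizes0.
- rewrite xz; apply: stabilizes_succ => n n0.
  by apply: stabilizes_n_of_stabilizes => //; apply: IH; rewrite xz osucc_gt.
- exact: stabilizes_limit.
Qed.

End Real.

Theorem theorem1p3 (R : realType) (xi : Ord) (n : nat) (delta : R)
    (f : seq Ord -> R) (n_gt0 : (0 < n)%N) (delta_gt0 : 0 < delta)
    (f_bounded : exists M : R, forall s, Gamma_n xi n s -> `|f s| <= M) :
  exists (a : 'I_n -> R) (theta e : seq Ord -> seq Ord),
    [/\ monotone (Gamma_n xi n) theta,
        extension (Gamma_n xi n) theta e,
        forall t, MAX (Gamma_n xi n) t ->
          \sum_(s \in [set s | Gamma_n xi n s /\ prefix s (e t)])
            prob_n R xi n s * f s
          <= delta + \sum_(i < n) a i &
        forall (i : 'I_n) (s : seq Ord), Lambda xi n i.+1 s ->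
          a i <= f (theta s)].
Proof.
have [M fM] := f_bounded.
(* With the one-point colour type [unit] the clause on colours is trivial. *)
have [a [v [_ [theta [e [th ext P]]]]]] :=
  stabilizes_n_of_stabilizes R xi n n_gt0 (stabilizes_all R xi) f M delta unit
    (fun=> tt) delta_gt0 fM.
exists (fun i => a i), theta, e; split=> //.
- by split=> t /ext[].
- move=> t /ext[[Ge _] _ [_ le]].
  have Tn := Gamma_n_tree xi (Gamma_tree xi) (Gamma_neq0 xi) n.
  by rewrite (fsbig_brsum _ _ _ _ _ Tn).
- by move=> i s Ls; rewrite -(level_Lambda _ _ _ _ Ls); apply: P; case: Ls.
Qed.
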